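(* Fix an integer $n\ge1$. (i) If $A=0$, $B=1$, then as $t\to1^-$, \begin{align*} D_n(t)\sim\;&2^{-2n(n+\beta+\gamma)}(2\pi)^n\frac{\Gamma\left(\frac{\beta+\gamma+1}{2}\right)G^2\left(\frac{\beta+\gamma+1}{2}\right)G^2\left(\frac{\beta+\gamma}{2}+1\right)}{G(\beta+\gamma+1)G(\beta+1)G(\gamma+1)}\\ &\times\frac{G(n+1)G(n+\beta+1)G(n+\gamma+1)G(n+\beta+\gamma+1)}{G^2\left(n+\frac{\beta+\gamma+1}{2}\right)G^2\left(n+\frac{\beta+\gamma}{2}+1\right)\Gamma\left(n+\frac{\beta+\gamma+1}{2}\right)}(1-t)^{n(n+\beta+\gamma)}. \end{align*} (ii) If $A=1$, $B=-1$, then as $t\to0^+$, \begin{align*} D_n(t)\sim\;&2^{-2n(n+\alpha+\gamma)}(2\pi)^n\frac{\Gamma\left(\frac{\alpha+\gamma+1}{2}\right)G^2\left(\frac{\alpha+\gamma+1}{2}\right)G^2\left(\frac{\alpha+\gamma}{2}+1\right)}{G(\alpha+\gamma+1)G(\alpha+1)G(\gamma+1)}\\ &\times\frac{G(n+1)G(n+\alpha+1)G(n+\gamma+1)G(n+\alpha+\gamma+1)}{G^2\left(n+\frac{\alpha+\gamma+1}{2}\right)G^2\left(n+\frac{\alpha+\gamma}{2}+1\right)\Gamma\left(n+\frac{\alpha+\gamma+1}{2}\right)}t^{n(n+\alpha+\gamma)}. \end{align*} Here $f\sim g$ means $f/g\to1$.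
   Context: Fix $\alpha,\beta,\gamma>0$. Let $\theta$ be the Heaviside function ($\theta(x)=1$ for $x>0$, $0$ otherwise). For $t\in(0,1)$ and constants $A,B$, put $w(x,t)=x^{\alpha}(1-x)^{\beta}|x-t|^{\gamma}(A+B\theta(x-t))$ on $[0,1]$ and $D_n(t)=\det\left(\int_0^1x^{i+j}w(x,t)dx\right)_{i,j=0}^{n-1}=\frac1{n!}\int_{[0,1]^n}\prod_{i<j}(x_i-x_j)^2\prod_jw(x_j,t)dx_j$. $G$ denotes the Barnes $G$-function, $G(x+1)=(2\pi)^{x/2}e^{-\frac12x(x+1)-\frac12\gamma_Ex^2}\prod_{k\ge1}\left[(1+\frac xk)^ke^{-x+\frac{x^2}{2k}}\right]$, with $\gamma_E$ the Euler–Mascheroni constant. *)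

(* Defs.v *)
From Stdlib Require Import Reals Lra ClassicalEpsilon Factorial.
Open Scope R_scope.

(* Limit of a real sequence (chosen via epsilon; the genuine limit whenever it exists). *)
Definition lim_seq (u : nat -> R) : R :=
  epsilon (inhabits 0) (fun l => Un_cv u l).

(* Riemann integral over [0,1] (the genuine value whenever f is Riemann integrable). *)
Definition RInt01 (f : R -> R) : R :=
  epsilon (inhabits 0)
    (fun v => exists pr : Riemann_integrable f 0 1, RiemannInt pr = v).

(* x^a for x >= 0 and a > 0 (with 0^a = 0). *)
Definition rpow (x a : R) : R :=
  if Rle_dec x 0 then 0 else Rpower x a.

Definition theta (x : R) : R := if Rlt_dec 0 x then 1 else 0.

Definition gammaE : R :=
  lim_seq (fun N => sum_f_R0 (fun k => / INR (S k)) N - ln (INR (S N))).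

Fixpoint prod1 (f : nat -> R) (N : nat) : R :=
  match N with
  | O => 1
  | S m => prod1 f m * f (S m)
  end.

(* Euler Gamma function via Gauss's limit formula (valid for x > 0):
   Gamma x = lim_N N! N^x / (x (x+1) ... (x+N)). *)
Definition Gamma (x : R) : R :=
  lim_seq (fun N => INR (fact N) * Rpower (INR N) x
                     / (x * prod1 (fun k => x + INR k) N)).

(* Barnes G-function: G(x+1) = (2pi)^{x/2} e^{-x(x+1)/2 - gammaE x^2/2}
   prod_{k>=1} (1+x/k)^k e^{-x + x^2/(2k)}; BarnesG y := G(y) with x = y - 1. *)
Definition BarnesG (y : R) : R :=
  let x := y - 1 in
  Rpower (2 * PI) (x / 2) * exp (- (1/2) * x * (x + 1) - (1/2) * gammaE * x ^ 2) *
  lim_seq (fun N => prod1 (fun k => (1 + x / INR k) ^ k * exp (- x + x ^ 2 / (2 * INR k))) N).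

Fixpoint detn (n : nat) (M : nat -> nat -> R) : R :=
  match n with
  | O => 1
  | S m => sum_f_R0 (fun j => (-1) ^ j * M 0%nat j *
             detn m (fun i k => M (S i) (if Nat.ltb k j then k else S k))) m
  end.

Definition w (alpha beta gamma A B t x : R) : R :=
  rpow x alpha * rpow (1 - x) beta * rpow (Rabs (x - t)) gamma * (A + B * theta (x - t)).

Definition Dn (alpha beta gamma A B : R) (n : nat) (t : R) : R :=
  detn n (fun i j => RInt01 (fun x => x ^ (i + j) * w alpha beta gamma A B t x)).

Definition Cconst (a gamma : R) (n : nat) : R :=
  let N := INR n in
  Rpower 2 (- (2 * N * (N + a + gamma))) * (2 * PI) ^ n *
  (Gamma ((a + gamma + 1) / 2) * (BarnesG ((a + gamma + 1) / 2)) ^ 2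
     * (BarnesG ((a + gamma) / 2 + 1)) ^ 2
   / (BarnesG (a + gamma + 1) * BarnesG (a + 1) * BarnesG (gamma + 1))) *
  (BarnesG (N + 1) * BarnesG (N + a + 1) * BarnesG (N + gamma + 1) * BarnesG (N + a + gamma + 1)
   / ((BarnesG (N + (a + gamma + 1) / 2)) ^ 2 * (BarnesG (N + (a + gamma) / 2 + 1)) ^ 2
      * Gamma (N + (a + gamma + 1) / 2))).

(* Main.v *)
Require Import Defs.
From Stdlib Require Import Reals Lra Lia Psatz ClassicalEpsilon Factorial.
From Coquelicot Require Import Coquelicot.
From mathcomp Require all_boot all_algebra Rstruct.
Open Scope R_scope.

(* The substitutions [x = 1 - (1-t) u] in (i) and [x = t u] in (ii) turn the moments into
   moments, on [0,1], of affine functions of [u] against [u^a (1-u)^gamma (1-su)^b], where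
   [s] is [1-t], resp. [t]. A Hankel determinant only sees the slope of the affine
   function, which gives the power [s^(n(n+a+gamma))] exactly, and the remaining
   determinant tends to that of the Beta integrals [B(a+i+j+1, gamma+1)].
   Writing these as quotients of Gamma values, one step of column elimination replaces
   the parameters by [(a+1, gamma+1)], whence a product of Gamma values; the recurrence
   [G(y+1) = kappa Gamma(y) G(y)] and the duplication formula identify it with the
   constant in terms of the Barnes function. *)

(** * Determinants *)

Section Determinants.
Import all_boot all_algebra Rstruct GRing.Theory.

(** Limits and integrals are chosen by [epsilon], so nothing is known about a value of [Gamma],
    [BarnesG] or [RInt01] before convergence or integrability is proved; passing to logarithms gives
    existence and positivity of the limits together. Moreover [Gamma] is Gauss's limit and not an
    integral: the bridge to the moments is the Beta integral, tied to Gauss's products by its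
    recurrence and its monotonicity. Positive exponents in the weight mean Beta parameters greater
    than 1. With powers extended by zero, all integrands are then continuous on the whole line, and
    neither improper integrals nor one-sided arguments at the endpoints occur. Since the power of
    [s] splits off exactly, the only analytic limit left is that of single moments as [s] tends to
    0. *)

Lemma sum_f_R0_big (f : nat -> R) (n : nat) : sum_f_R0 f n = (\sum_(i < n.+1) f i)%R.
Proof.
elim: n => [|n IH]; first by rewrite big_ord1.
by rewrite big_ord_recr /= -IH.
Qed.

Lemma prod1_big (f : nat -> R) (n : nat) : prod1 f n = (\prod_(i < n) f i.+1)%R.
Proof.
elim: n => [|n IH] /=; first by rewrite big_ord0.
by rewrite big_ord_recr /= -IH.
Qed.

(** [detn] is the Laplace expansion along the first row, and its column-skipping index is [bump].
    The link gives access to the multiplicativity of the determinant. *)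
Lemma detn_det (n : nat) (M : nat -> nat -> R) :
  detn n M = (\det (\matrix_(i < n, j < n) M i j))%R.
Proof.
elim: n M => [|n IH] M; first by rewrite det_mx00.
rewrite (expand_det_row _ ord0) /= sum_f_R0_big; apply: eq_bigr => j _.
rewrite IH mxE /cofactor /= add0n -RpowE mulrCA mulrA; congr (_ * _ * \det _)%R.
apply/matrixP => i k; rewrite !mxE lift0 /=; congr (M _ _).
rewrite /bump; have [h|h] := PeanoNat.Nat.ltb_spec k j.
  by rewrite leqNgt (introT ltP h).
by rewrite (introT leP h).
Qed.

Lemma eq_detn (n : nat) (M M' : nat -> nat -> R) :
  (forall i j, (i < n)%coq_nat -> (j < n)%coq_nat -> M i j = M' i j) ->
  detn n M = detn n M'.
Proof.
move=> h; rewrite !detn_det; congr (\det _)%R; apply/matrixP => i j.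
by rewrite !mxE h //; apply/ltP.
Qed.

(** Multiplication by diagonal matrices on both sides. The predecessors appear because [prod1]
    counts from 1. *)
Lemma detn_scal (n : nat) (r c : nat -> R) (M : nat -> nat -> R) :
  detn n (fun i j => r i * c j * M i j) =
  prod1 (fun i => r i.-1) n * prod1 (fun i => c i.-1) n * detn n M.
Proof.
rewrite !detn_det !prod1_big.
have -> : (\matrix_(i < n, j < n) (r i * c j * M i j) =
   diag_mx (\row_(i < n) r i) *m (\matrix_(i < n, j < n) M i j)
     *m diag_mx (\row_(i < n) c i))%R.
  apply/matrixP => i j; rewrite mul_mx_diag mul_diag_mx !mxE.
  by rewrite -!mulrA; congr (_ * _)%R; rewrite mulrC.
rewrite !det_mulmx !det_diag mulrAC; congr (_ * _ * _)%R;
  by apply: eq_bigr => i _; rewrite mxE.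
Qed.

(** The matrix is [L H L^T] with [L] lower triangular, so only the diagonal of [L] survives,
    squared. The case [n = 0] is apart because [sum_f_R0] always has at least one term. *)
Lemma detn_lower_congr (n : nat) (L H : nat -> nat -> R) :
  (forall i p, (i < p)%coq_nat -> L i p = 0) ->
  detn n (fun i j => sum_f_R0 (fun p =>
      sum_f_R0 (fun q => L i p * L j q * H p q) n.-1) n.-1) =
  prod1 (fun i => L i.-1 i.-1) n ^ 2 * detn n H.
Proof.
move=> hL; case: n => [|n]; first by rewrite /=; ring.
rewrite !detn_det prod1_big RpowE.
set A := (\matrix_(i < n.+1, j < n.+1) L i j)%R.
have -> : (\matrix_(i < n.+1, j < n.+1) sum_f_R0 (fun p =>
      sum_f_R0 (fun q => L i p * L j q * H p q) n) n =
   A *m (\matrix_(i < n.+1, j < n.+1) H i j) *m A^T)%R.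
  apply/matrixP => i j; rewrite !mxE sum_f_R0_big.
  under eq_bigr => p _ do rewrite sum_f_R0_big.
  rewrite exchange_big /=; apply: eq_bigr => q _; rewrite !mxE mulr_suml.
  apply: eq_bigr => p _; rewrite !mxE.
  by rewrite ?RmultE mulrAC.
have detA : (\det A = \prod_(i < n.+1) L i i)%R.
  rewrite det_trig; first by apply: eq_bigr => i _; rewrite mxE.
  by apply/is_trig_mxP => i j h; rewrite mxE hL //; apply/ltP.
by rewrite !det_mulmx det_tr detA mulrAC -expr2.
Qed.

(* Clearing the first row by the column operations [C_(j+1) - l_j C_j]. *)
Lemma detn_column_reduction (n : nat) (l : nat -> R) (M : nat -> nat -> R) :
  (forall j, M 0%N j.+1 = l j * M 0%N j) ->
  detn n.+1 M =
  M 0%N 0%N * detn n (fun i j => M i.+1 j.+1 - l j * M i.+1 j).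
Proof.
move=> h; rewrite !detn_det.
(* Right multiplication by this unit upper bidiagonal matrix performs all column operations at once,
   each on the original columns. *)
pose A : 'M[R]_n.+1 := (\matrix_(i < n.+1, j < n.+1)
  (if i == j then 1 else if j == i.+1 :> nat then - l i else 0))%R.
have detA : (\det A = 1)%R.
  rewrite -det_tr det_trig; last first.
    apply/is_trig_mxP => i j hij; rewrite !mxE; case: eqP => [e|_].
      by rewrite e ltnn in hij.
    by case: eqP => // e; move: hij; rewrite e ltnNge leqnSn.
  by apply: big1 => i _; rewrite !mxE eqxx.
set X := (\matrix_(i < n.+1, j < n.+1) M i j)%R.
have E0 i : (X *m A)%R i ord0 = M i 0%N.
  rewrite mxE (bigD1 ord0) //= !mxE eqxx mulr1 big1 ?addr0 // => k hk.
  by rewrite !mxE (negbTE hk) mulr0.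
have ES i (j : 'I_n) : ((X *m A) i (lift ord0 j) = M i j.+1 - l j * M i j)%R.
  rewrite mxE (bigD1 (lift ord0 j)) //= !mxE eqxx mulr1.
  rewrite (bigD1 (widen_ord (leqnSn n) j)) /=; last first.
    by apply/eqP => /(congr1 val) /=; rewrite /bump /= add1n => /eqP; rewrite ltn_eqF.
  rewrite !mxE /= big1 ?addr0.
    case: eqP => [/(congr1 val)/=/eqP|_]; first by rewrite /bump /= add1n ltn_eqF.
    by rewrite /bump /= add1n eqxx mulrN mulrC.
  move=> k /andP[k1 k2]; rewrite !mxE (negbTE k1) /= /bump /= add1n eqSS.
  case: eqP => [e|_]; last by rewrite mulr0.
  by move/eqP: k2; case; apply: val_inj.
have -> : (\det X = \det (X *m A))%R by rewrite det_mulmx detA mulr1.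
rewrite (expand_det_row _ ord0) big_ord_recl /= E0 big1 ?addr0.
  rewrite /cofactor /= expr0 mul1r; congr (_ * \det _)%R.
  by apply/matrixP => i j; rewrite mxE mxE ES mxE.
by move=> j _; rewrite ES h subrr mul0r.
Qed.
End Determinants.

(** * The Gamma function *)

Lemma lim_seq_eq (u : nat -> R) (l : R) : is_lim_seq u l -> lim_seq u = l.
Proof.
intros H. apply is_lim_seq_Reals in H.
unfold lim_seq. apply (UL_sequence u); [|exact H].
apply epsilon_spec. exists l; exact H.
Qed.

(* The bound telescopes: [v n - C/(n+1)] increases and [v n + C/(n+1)] decreases. *)
Lemma ex_lim_seq_of_quadratic_steps (v : nat -> R) (C : R) :
  (forall n, Rabs (v (S n) - v n) <= C / ((INR n + 1) * (INR n + 2))) ->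
  ex_finite_lim_seq v.
Proof.
intros H.
assert (E : forall n, C / ((INR n + 1) * (INR n + 2)) = C / (INR n + 1) - C / (INR (S n) + 1)).
{ intros n. rewrite S_INR. pose proof (pos_INR n). field. lra. }
assert (C0 : 0 <= C).
{ pose proof (H 0%nat) as H0. pose proof (Rabs_pos (v 1%nat - v 0%nat)). simpl in H0. lra. }
assert (L : ex_finite_lim_seq (fun n => v n - C / (INR n + 1))).
{ apply (ex_finite_lim_seq_incr _ (v 0%nat + C)).
  - intros n. pose proof (H n) as Hn. rewrite E in Hn. apply Rabs_le_between in Hn. lra.
  - intros n. apply Rle_trans with (v n + C / (INR n + 1)).
    + pose proof (pos_INR n).
      assert (0 <= C / (INR n + 1)) by (apply Rmult_le_pos; [lra| left; apply Rinv_0_lt_compat; lra]).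
      lra.
    + induction n as [|n IH]; [simpl; lra|].
      pose proof (H n) as Hn. rewrite E in Hn. apply Rabs_le_between in Hn. lra. }
destruct L as [l Hl]. exists (l + 0).
apply is_lim_seq_ext with (fun n => (v n - C / (INR n + 1)) + C / (INR n + 1)).
{ intros n; ring. }
apply is_lim_seq_plus'; [exact Hl|].
replace 0 with (C * 0) by ring.
apply (is_lim_seq_scal_l (fun n => / (INR n + 1)) C 0).
apply is_lim_seq_ext with (fun n => / INR (S n)).
{ intros n; rewrite S_INR; reflexivity. }
apply (is_lim_seq_incr_1 (fun n => / INR n)).
change (Finite 0) with (Rbar_inv p_infty).
apply is_lim_seq_inv; [apply is_lim_seq_INR|discriminate].
Qed.

(** Both bounds are [ln t <= t - 1], at [t = b/a] and at [t = a/b]. *)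
Lemma ln_diff_bounds (a b : R) : 0 < a -> 0 < b ->
  (b - a) / b <= ln b - ln a <= (b - a) / a.
Proof.
assert (K : forall a b, 0 < a -> 0 < b -> ln b - ln a <= (b - a) / a).
{ intros x y Hx Hy. rewrite <- ln_div by assumption.
  replace ((y - x) / x) with (y / x - 1) by (field; lra).
  assert (0 < y / x) by (apply Rdiv_lt_0_compat; assumption).
  pose proof (exp_ineq1_le (ln (y / x))) as Hl. rewrite exp_ln in Hl by assumption. lra. }
intros Ha Hb; split; [|apply K; assumption].
pose proof (K b a Hb Ha).
replace ((b - a) / b) with (- ((a - b) / b)) by (field; lra). lra.
Qed.

Lemma is_lim_seq_ratio (c d : R) : is_lim_seq (fun n => (INR n + c) / (INR n + d)) 1.
Proof.
assert (P : is_lim_seq (fun n => INR n + d) p_infty).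
{ apply is_lim_seq_plus with p_infty d; [apply is_lim_seq_INR|apply is_lim_seq_const|reflexivity]. }
assert (E : eventually (fun n => 0 < INR n + d)).
{ apply is_lim_seq_spec in P. apply (P 0). }
apply is_lim_seq_ext_loc with (fun n => 1 + (c - d) * / (INR n + d)).
{ destruct E as [N HN]. exists N. intros n Hn. pose proof (HN n Hn). field. lra. }
replace (Finite 1) with (Finite (1 + (c - d) * 0)) by (f_equal; ring).
apply is_lim_seq_plus'; [apply is_lim_seq_const|].
apply (is_lim_seq_scal_l (fun n => / (INR n + d)) (c - d) 0).
change (Finite 0) with (Rbar_inv p_infty).
apply is_lim_seq_inv; [exact P|discriminate].
Qed.

Lemma prod1_S (f : nat -> R) (n : nat) : prod1 f (S n) = prod1 f n * f (S n).
Proof. reflexivity. Qed.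

Lemma prod1_pos (f : nat -> R) (n : nat) : (forall k, 0 < f (S k)) -> 0 < prod1 f n.
Proof.
intros H; induction n as [|n IH]; simpl; [lra|]. apply Rmult_lt_0_compat; auto.
Qed.

Lemma prod1_ext (f g : nat -> R) (n : nat) :
  (forall k, f (S k) = g (S k)) -> prod1 f n = prod1 g n.
Proof.
intros H; induction n as [|n IH]; simpl; [reflexivity|]. rewrite IH, H; reflexivity.
Qed.

Lemma prod1_head (f : nat -> R) (n : nat) :
  prod1 f (S n) = f 1%nat * prod1 (fun k => f (S k)) n.
Proof.
induction n as [|n IH]; [simpl; ring|].
rewrite prod1_S, IH; simpl; ring.
Qed.

Lemma prod1_mult (f g : nat -> R) (n : nat) :
  prod1 (fun k => f k * g k) n = prod1 f n * prod1 g n.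
Proof. induction n as [|n IH]; simpl; [ring|]. rewrite IH; ring. Qed.

Lemma prod1_const (c : R) (n : nat) : prod1 (fun _ => c) n = c ^ n.
Proof. induction n as [|n IH]; simpl; [reflexivity|]. rewrite IH; ring. Qed.

Definition gauss (x : R) (N : nat) : R :=
  INR (fact N) * Rpower (INR N) x / (x * prod1 (fun k => x + INR k) N).

Lemma gauss_den_pos (x : R) (N : nat) : 0 < x -> 0 < prod1 (fun k => x + INR k) N.
Proof.
intros Hx. apply prod1_pos. intros k. pose proof (pos_INR (S k)). lra.
Qed.

Lemma gauss_pos (x : R) (N : nat) : 0 < x -> 0 < gauss x N.
Proof.
intros Hx. unfold gauss. pose proof (gauss_den_pos x N Hx).
apply Rdiv_lt_0_compat; apply Rmult_lt_0_compat; try assumption.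
- apply INR_fact_lt_0.
- apply exp_pos.
Qed.

Lemma ln_gauss (x : R) (N : nat) : 0 < x ->
  ln (gauss x N) = ln (INR (fact N)) + x * ln (INR N) - ln x - ln (prod1 (fun k => x + INR k) N).
Proof.
intros Hx. unfold gauss. pose proof (gauss_den_pos x N Hx). pose proof (INR_fact_lt_0 N).
assert (0 < Rpower (INR N) x) by apply exp_pos.
rewrite ln_div by (apply Rmult_lt_0_compat; assumption).
rewrite !ln_mult by assumption. unfold Rpower; rewrite ln_exp. ring.
Qed.

(** Indices start at 1 because the formula contains [ln N]. *)
Lemma ln_gauss_step (x : R) (n : nat) : 0 < x ->
  ln (gauss x (S (S n))) - ln (gauss x (S n)) =
  x * (ln (INR n + 2) - ln (INR n + 1)) - (ln (x + INR n + 2) - ln (INR n + 2)).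
Proof.
intros Hx. pose proof (pos_INR n). rewrite !ln_gauss by assumption.
replace (fact (S (S n))) with (S (S n) * fact (S n))%nat by reflexivity.
rewrite (prod1_S _ (S n)).
pose proof (gauss_den_pos x (S n) Hx). pose proof (INR_fact_lt_0 (S n)).
rewrite mult_INR, !S_INR.
rewrite !ln_mult by lra.
replace (INR n + 1 + 1) with (INR n + 2) by ring.
replace (x + (INR n + 2)) with (x + INR n + 2) by ring. ring.
Qed.

Lemma is_lim_gauss (x : R) : 0 < x -> is_lim_seq (gauss x) (Gamma x) /\ 0 < Gamma x.
Proof.
intros Hx.
assert (L : ex_finite_lim_seq (fun n => ln (gauss x (S n)))).
(* By [ln_diff_bounds] each increment lies between [0] and [x/(n+1) - x/(x+n+2) =
   x(1+x)/((n+1)(x+n+2))]. *)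
{ apply ex_lim_seq_of_quadratic_steps with (x * (1 + x)).
  intros n. rewrite ln_gauss_step by assumption. pose proof (pos_INR n).
  pose proof (ln_diff_bounds (INR n + 1) (INR n + 2) ltac:(lra) ltac:(lra)) as [A1 A2].
  pose proof (ln_diff_bounds (INR n + 2) (x + INR n + 2) ltac:(lra) ltac:(lra)) as [B1 B2].
  replace ((INR n + 2 - (INR n + 1)) / (INR n + 2)) with (/ (INR n + 2)) in A1 by (field; lra).
  replace ((INR n + 2 - (INR n + 1)) / (INR n + 1)) with (/ (INR n + 1)) in A2 by (field; lra).
  replace ((x + INR n + 2 - (INR n + 2)) / (INR n + 2)) with (x * / (INR n + 2)) in B2 by (field; lra).
  replace ((x + INR n + 2 - (INR n + 2)) / (x + INR n + 2)) with (x * / (x + INR n + 2)) in B1 by (field; lra).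
  apply (Rmult_le_compat_l x) in A1; [|lra]. apply (Rmult_le_compat_l x) in A2; [|lra].
  assert (x * / (INR n + 1) - x * / (x + INR n + 2) <= x * (1 + x) / ((INR n + 1) * (INR n + 2))).
  { replace (x * / (INR n + 1) - x * / (x + INR n + 2))
      with (x * (1 + x) * / (INR n + 1) * / (x + INR n + 2)) by (field; lra).
    replace (x * (1 + x) / ((INR n + 1) * (INR n + 2)))
      with (x * (1 + x) * / (INR n + 1) * / (INR n + 2)) by (field; lra).
    apply Rmult_le_compat_l.
    - apply Rmult_le_pos; [nra|]. left; apply Rinv_0_lt_compat; lra.
    - apply Rinv_le_contravar; lra. }
  apply Rabs_le. assert (0 <= x * (1 + x) / ((INR n + 1) * (INR n + 2))).
  { apply Rmult_le_pos; [nra|]. left; apply Rinv_0_lt_compat; nra. }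
  lra. }
destruct L as [l Hl].
assert (G : is_lim_seq (gauss x) (exp l)).
{ apply is_lim_seq_incr_1.
  apply is_lim_seq_ext with (fun n => exp (ln (gauss x (S n)))).
  { intros n. apply exp_ln. apply gauss_pos; assumption. }
  apply is_lim_seq_continuous; [apply derivable_continuous_pt, derivable_pt_exp|exact Hl]. }
assert (E : Gamma x = exp l) by exact (lim_seq_eq _ _ G).
rewrite E. split; [exact G|apply exp_pos].
Qed.

Lemma Gamma_pos (x : R) : 0 < x -> 0 < Gamma x.
Proof. intros Hx; apply is_lim_gauss, Hx. Qed.

Lemma Gamma_eq (x l : R) : is_lim_seq (gauss x) l -> Gamma x = l.
Proof. exact (lim_seq_eq _ _). Qed.

Lemma Gamma_succ (x : R) : 0 < x -> Gamma (x + 1) = x * Gamma x.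
Proof.
intros Hx. apply Gamma_eq.
apply is_lim_seq_ext_loc with (fun N => x * gauss x N * ((INR N + 0) / (INR N + (x + 1)))).
{ exists 1%nat. intros N HN. unfold gauss.
  assert (0 < INR N) by (apply lt_0_INR; lia).
  rewrite Rpower_plus, Rpower_1 by assumption.
  pose proof (gauss_den_pos x N Hx). pose proof (gauss_den_pos (x + 1) N ltac:(lra)).
  assert (E : prod1 (fun k => x + INR k) N * (x + INR N + 1) =
              (x + 1) * prod1 (fun k => x + 1 + INR k) N).
  { pose proof (prod1_head (fun k => x + INR k) N) as E. rewrite prod1_S, S_INR in E. change (INR 1) with 1 in E.
    rewrite <- Rplus_assoc in E. rewrite E. f_equal. apply prod1_ext.
    intros k. rewrite (S_INR (S k)). ring. }
  replace (prod1 (fun k => x + 1 + INR k) N)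
    with (prod1 (fun k => x + INR k) N * (x + INR N + 1) / (x + 1))
    by (rewrite E; field; lra).
  field. lra. }
replace (Finite (x * Gamma x)) with (Finite (x * Gamma x * 1)) by (f_equal; ring).
apply is_lim_seq_mult'; [|apply is_lim_seq_ratio].
apply (is_lim_seq_scal_l (gauss x) x (Gamma x)). apply is_lim_gauss, Hx.
Qed.

Lemma prod1_fact (N : nat) : prod1 (fun k => 1 + INR k) N = INR (fact (S N)).
Proof.
induction N as [|N IH]; [simpl; ring|].
rewrite prod1_S, IH. change (fact (S (S N))) with (S (S N) * fact (S N))%nat.
rewrite mult_INR, (S_INR (S N)). ring.
Qed.

Lemma Gamma_1 : Gamma 1 = 1.
Proof.
apply Gamma_eq.
apply is_lim_seq_ext_loc with (fun N => (INR N + 0) / (INR N + 1)); [|apply is_lim_seq_ratio].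
exists 1%nat. intros N HN. unfold gauss.
assert (0 < INR N) by (apply lt_0_INR; lia).
rewrite Rpower_1, prod1_fact by assumption.
change (fact (S N)) with (S N * fact N)%nat. rewrite mult_INR, S_INR.
pose proof (INR_fact_lt_0 N). field. lra.
Qed.

(** Doubled, the factors [z + k] and [z + 1/2 + k] become [2z + 2k] and [2z + 2k + 1]; interleaved,
    they run through [2z, ..., 2z + 2N + 1]. There are [2N + 2] of them, whence [4 * 4^N]. *)
Lemma prod1_duplication (z : R) (N : nat) :
  z * prod1 (fun k => z + INR k) N * ((z + 1/2) * prod1 (fun k => z + 1/2 + INR k) N)
  * (4 * 4 ^ N) = 2 * z * prod1 (fun k => 2 * z + INR k) (S (2 * N)).
Proof.
induction N as [|N IH]; [simpl; field|].
replace (S (2 * S N)) with (S (S (S (2 * N)))) by lia.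
rewrite (prod1_S _ (S (S _))), (prod1_S _ (S (2 * N))).
rewrite <- !Rmult_assoc, <- IH, !prod1_S, !S_INR, mult_INR, <- tech_pow_Rmult.
change (INR 2) with 2. field.
Qed.

(* The ratio of the Gauss products for [Gamma z Gamma (z+1/2)] and [Gamma (2z)]
   depends on [z] only through [(N/(2N+1))^(2z)]. *)
Lemma Gamma_duplication (z : R) : 0 < z ->
  Gamma z * Gamma (z + 1/2) = 2 * Gamma (1/2) * Rpower 2 (- (2 * z)) * Gamma (2 * z).
Proof.
pose (c := fun N => INR (fact N) ^ 2 * Rpower (INR N) (1/2) * (4 * 4 ^ N) / INR (fact (S (2 * N)))).
assert (I : forall z N, 0 < z -> (1 <= N)%nat ->
   gauss z N * gauss (z + 1/2) N =
   c N * Rpower (INR N / INR (S (2 * N))) (2 * z) * gauss (2 * z) (S (2 * N))).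
{ intros x N Hx HN. unfold gauss, c.
  assert (0 < INR N) by (apply lt_0_INR; lia).
  assert (0 < INR (S (2 * N))) by (apply lt_0_INR; lia).
  assert (E : Rpower (INR N / INR (S (2 * N))) (2 * x) =
              Rpower (INR N) (2 * x) / Rpower (INR (S (2 * N))) (2 * x)).
  { unfold Rpower, Rdiv. rewrite <- exp_Ropp, <- exp_plus. f_equal.
    change (INR N * / INR (S (2 * N))) with (INR N / INR (S (2 * N))).
    rewrite ln_div by assumption. ring. }
  rewrite E, <- prod1_duplication.
  replace (Rpower (INR N) (x + 1/2)) with (Rpower (INR N) x * Rpower (INR N) (1/2))
    by (rewrite Rpower_plus; reflexivity).
  replace (Rpower (INR N) (2 * x)) with (Rpower (INR N) x * Rpower (INR N) x)
    by (rewrite <- Rpower_plus; f_equal; ring).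
  pose proof (gauss_den_pos x N Hx). pose proof (gauss_den_pos (x + 1/2) N ltac:(lra)).
  pose proof (INR_fact_lt_0 (S (2 * N))).
  assert (0 < Rpower (INR (S (2 * N))) (2 * x)) by apply exp_pos.
  assert (0 < 4 ^ N) by (apply pow_lt; lra).
  field. repeat split; lra. }
assert (S2 : filterlim (fun N => S (2 * N)) eventually eventually).
{ apply eventually_subseq. intros n; lia. }
assert (P : forall z, 0 < z -> is_lim_seq (fun N => Rpower (INR N / INR (S (2 * N))) (2 * z)) (Rpower 2 (- (2 * z)))).
{ intros x Hx.
  replace (Rpower 2 (- (2 * x))) with (Rpower (1/2) (2 * x)).
  2:{ unfold Rpower, Rdiv. rewrite Rmult_1_l, ln_Rinv by lra. f_equal; ring. }
  apply (is_lim_seq_continuous (fun y => Rpower y (2 * x))).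
  - apply derivable_continuous_pt. exists (2 * x * Rpower (1/2) (2 * x - 1)).
    apply derivable_pt_lim_power. lra.
  - apply is_lim_seq_ext with (fun N => 1/2 * ((INR N + 0) / (INR N + 1/2))).
    + intros N. rewrite S_INR, mult_INR. pose proof (pos_INR N). change (INR 2) with 2. field. lra.
    + replace (Finite (1/2)) with (Finite (1/2 * 1)) by (f_equal; ring).
      apply (is_lim_seq_scal_l _ (1/2) 1), is_lim_seq_ratio. }
assert (U : forall z, 0 < z -> is_lim_seq c
   (Gamma z * Gamma (z + 1/2) / (Rpower 2 (- (2 * z)) * Gamma (2 * z)))).
{ intros x Hx.
  assert (G2 : is_lim_seq (fun N => gauss (2 * x) (S (2 * N))) (Gamma (2 * x))).
  { apply (is_lim_seq_subseq (gauss (2 * x)) (Gamma (2 * x)) (fun N => S (2 * N)) S2).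
    apply is_lim_gauss; lra. }
  apply is_lim_seq_ext_loc with (fun N => gauss x N * gauss (x + 1/2) N /
     (Rpower (INR N / INR (S (2 * N))) (2 * x) * gauss (2 * x) (S (2 * N)))).
  { exists 1%nat. intros N HN. rewrite I by assumption.
    pose proof (gauss_pos (2 * x) (S (2 * N)) ltac:(lra)).
    assert (0 < Rpower (INR N / INR (S (2 * N))) (2 * x)) by apply exp_pos.
    field. split; lra. }
  apply is_lim_seq_div'.
  - apply is_lim_seq_mult'; apply is_lim_gauss; lra.
  - apply is_lim_seq_mult'; [apply P, Hx|exact G2].
  - assert (0 < Rpower 2 (- (2 * x))) by apply exp_pos.
    pose proof (Gamma_pos (2 * x) ltac:(lra)). nra. }
intros Hz.
(* The sequence [c] does not involve [z], so its limits computed at [z] and at [1/2] agree; the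
   second one gives the constant, as [Gamma 1 = 1]. *)
assert (Q := is_lim_seq_unique _ _ (U z Hz)).
rewrite (is_lim_seq_unique _ _ (U (1/2) ltac:(lra))) in Q. injection Q as Q.
replace (1/2 + 1/2) with 1 in Q by field. replace (2 * (1/2)) with 1 in Q by field.
rewrite Gamma_1, Rpower_Ropp, Rpower_1 in Q by lra.
assert (0 < Rpower 2 (- (2 * z))) by apply exp_pos.
pose proof (Gamma_pos (2 * z) ltac:(lra)).
replace (2 * Gamma (1/2)) with (Gamma (1/2) * 1 / (/ 2 * 1)) by field.
rewrite Q. field. split; lra.
Qed.

(** * The Beta integral *)

(** Equalities left by the integration lemmas may live in a carrier that is only convertible to [R];
    the cast lets [ring] recognise it. *)
Ltac Rring := match goal with |- @eq _ ?a ?b => change (@eq R a b) end; ring.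

(** * Real powers extended by zero: algebra, continuity, derivative *)

Lemma rpow_pos (x a : R) : 0 < x -> rpow x a = Rpower x a.
Proof. intros Hx; unfold rpow; destruct (Rle_dec x 0); [lra|reflexivity]. Qed.

Lemma rpow_nonpos (x a : R) : x <= 0 -> rpow x a = 0.
Proof. intros Hx; unfold rpow; destruct (Rle_dec x 0); [reflexivity|lra]. Qed.

Lemma rpow_gt_0 (x a : R) : 0 < x -> 0 < rpow x a.
Proof. intros Hx; rewrite rpow_pos by assumption; apply exp_pos. Qed.

Lemma rpow_ge_0 (x a : R) : 0 <= rpow x a.
Proof.
destruct (Rle_lt_dec x 0) as [h|h]; [rewrite rpow_nonpos by assumption; lra|].
left; apply rpow_gt_0, h.
Qed.

Lemma rpow_mult_distr (s x a : R) : 0 < s -> rpow (s * x) a = Rpower s a * rpow x a.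
Proof.
intros Hs. destruct (Rle_lt_dec x 0) as [h|h].
- rewrite !rpow_nonpos by nra. ring.
- rewrite !rpow_pos by nra. symmetry; apply Rpower_mult_distr; assumption.
Qed.

Lemma rpow_plus (x a b : R) : rpow x (a + b) = rpow x a * rpow x b.
Proof.
destruct (Rle_lt_dec x 0) as [h|h].
- rewrite !rpow_nonpos by assumption. ring.
- rewrite !rpow_pos by assumption. apply Rpower_plus.
Qed.

Lemma rpow_1 (x : R) : 0 <= x -> rpow x 1 = x.
Proof.
intros [h|h].
- rewrite rpow_pos by assumption. apply Rpower_1, h.
- subst x. apply rpow_nonpos; lra.
Qed.

Lemma pow_mult_rpow (x a : R) (k : nat) : 0 <= x -> x ^ k * rpow x a = rpow x (a + INR k).
Proof.
intros [h|h].
- rewrite !rpow_pos by assumption. rewrite <- Rpower_pow, <- Rpower_plus by assumption.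
  f_equal; ring.
- subst x. rewrite !rpow_nonpos by lra. ring.
Qed.

Lemma rpow_le (x y a : R) : 0 <= a -> x <= y -> rpow x a <= rpow y a.
Proof.
intros Ha Hxy. destruct (Rle_lt_dec x 0) as [h|h].
- rewrite (rpow_nonpos x) by assumption. apply rpow_ge_0.
- rewrite !rpow_pos by lra. apply Rle_Rpower_l; [assumption|lra].
Qed.

Lemma rpow_1_l (a : R) : rpow 1 a = 1.
Proof. rewrite rpow_pos by lra. unfold Rpower. rewrite ln_1, Rmult_0_r. apply exp_0. Qed.

Lemma rpow_antitone (x a b : R) : x <= 1 -> a <= b -> rpow x b <= rpow x a.
Proof.
intros Hx Hab. destruct (Rle_lt_dec x 0) as [h|h].
- rewrite !rpow_nonpos by assumption. lra.
- replace b with (a + (b - a)) by ring. rewrite rpow_plus.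
  pose proof (rpow_ge_0 x a). pose proof (rpow_le x 1 (b - a) ltac:(lra) Hx) as H1.
  rewrite rpow_1_l in H1. nra.
Qed.

Lemma rpow_locally_0 (a : R) (eps : posreal) : 0 < a ->
  locally 0 (fun y => rpow y a < eps).
Proof.
intros Ha. assert (Hd : 0 < Rpower eps (/ a)) by apply exp_pos.
exists (mkposreal _ Hd). intros y Hy.
assert (y < Rpower eps (/ a)).
{ apply Rabs_lt_between' in Hy. simpl in Hy. lra. }
destruct (Rle_lt_dec y 0) as [h|h].
- rewrite rpow_nonpos by assumption. apply cond_pos.
- rewrite rpow_pos by assumption.
  replace (pos eps) with (Rpower (Rpower eps (/ a)) a).
  + apply Rlt_Rpower_l; [assumption|lra].
  + rewrite Rpower_mult, Rinv_l by lra. apply Rpower_1, cond_pos.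
Qed.

Lemma locally_pos (x : R) : 0 < x -> locally x (fun y => 0 < y).
Proof. intros Hx. exact (open_gt 0 x Hx). Qed.

Lemma locally_neg (x : R) : x < 0 -> locally x (fun y => y < 0).
Proof. intros Hx. exact (open_lt 0 x Hx). Qed.

Lemma is_derive_Rpower (a x : R) : 0 < x ->
  is_derive (fun y => Rpower y a) x (a * Rpower x (a - 1)).
Proof. intros Hx. apply is_derive_Reals, derivable_pt_lim_power, Hx. Qed.

Lemma continuous_rpow (a x : R) : 0 < a -> continuous (fun y => rpow y a) x.
Proof.
intros Ha. destruct (Rtotal_order x 0) as [h|[h|h]].
- apply continuous_ext_loc with (fun _ => 0).
  + apply filter_imp with (2 := locally_neg x h). intros y Hy. symmetry; apply rpow_nonpos; lra.
  + apply continuous_const.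
- subst x. apply continuity_pt_filterlim, continuity_pt_locally. intros eps.
  apply filter_imp with (2 := rpow_locally_0 a eps Ha). intros y Hy.
  rewrite (rpow_nonpos 0) by lra. rewrite Rminus_0_r, Rabs_pos_eq by apply rpow_ge_0. exact Hy.
- apply continuous_ext_loc with (fun y => Rpower y a).
  + apply filter_imp with (2 := locally_pos x h). intros y Hy. symmetry; apply rpow_pos, Hy.
  + apply (ex_derive_continuous (fun y => Rpower y a)).
    exists (a * Rpower x (a - 1)). apply is_derive_Rpower, h.
Qed.

(** For [a > 1] the extension by zero is differentiable at 0 too, the difference quotient there
    being [rpow k (a - 1)]. Integration by parts can thus be done on all of [0,1]. *)
Lemma is_derive_rpow (a x : R) : 1 < a -> is_derive (fun y => rpow y a) x (a * rpow x (a - 1)).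
Proof.
intros Ha. destruct (Rtotal_order x 0) as [h|[h|h]].
- apply is_derive_ext_loc with (fun _ => 0).
  + apply filter_imp with (2 := locally_neg x h). intros y Hy. symmetry; apply rpow_nonpos; lra.
  + rewrite rpow_nonpos, Rmult_0_r by lra. apply (is_derive_const 0).
- subst x. apply is_derive_Reals. intros eps Heps.
  destruct (rpow_locally_0 (a - 1) (mkposreal eps Heps) ltac:(lra)) as [d Hd].
  exists d. intros k Hk0 Hk.
  rewrite Rplus_0_l, !(rpow_nonpos 0) by lra.
  destruct (Rle_lt_dec k 0) as [h|h].
  + rewrite rpow_nonpos by assumption.
    replace ((0 - 0) / k - a * 0) with 0 by (field; assumption). rewrite Rabs_R0; exact Heps.
  + replace a with (1 + (a - 1)) at 1 by ring. rewrite rpow_plus, rpow_1 by lra.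
    replace ((k * rpow k (a - 1) - 0) / k - a * 0) with (rpow k (a - 1)) by (field; lra).
    rewrite Rabs_pos_eq by apply rpow_ge_0. apply Hd.
    change (Rabs (k - 0) < d). rewrite Rminus_0_r; exact Hk.
- rewrite rpow_pos by assumption.
  apply is_derive_ext_loc with (fun y => Rpower y a); [|apply is_derive_Rpower, h].
  apply filter_imp with (2 := locally_pos x h). intros y Hy. symmetry; apply rpow_pos, Hy.
Qed.

Lemma continuous_rpow_comp (f : R -> R) (a x : R) : 0 < a -> continuous f x ->
  continuous (fun y => rpow (f y) a) x.
Proof.
intros Ha Hf. apply (continuous_comp f (fun y => rpow y a)); [exact Hf|].
apply continuous_rpow, Ha.
Qed.

Lemma continuous_affine (c d x : R) : continuous (fun y => c + d * y) x.
Proof.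
apply (ex_derive_continuous (fun y => c + d * y)). auto_derive. exact I.
Qed.

Lemma continuous_one_minus (x : R) : continuous (fun y => 1 - y) x.
Proof. apply (ex_derive_continuous (fun y => 1 - y)). auto_derive. exact I. Qed.

Lemma is_derive_rpow_one_minus (b x : R) : 1 < b ->
  is_derive (fun u => rpow (1 - u) b) x (- (b * rpow (1 - x) (b - 1))).
Proof.
intros Hb.
replace (- (b * rpow (1 - x) (b - 1))) with (scal (-1) (b * rpow (1 - x) (b - 1)))
  by (unfold scal; simpl; unfold mult; simpl; ring).
apply (is_derive_comp (fun u => rpow u b) (fun u => 1 - u)).
- apply is_derive_rpow, Hb.
- auto_derive; [exact I|reflexivity].
Qed.

Definition Beta (x y : R) : R := RInt (fun u => rpow u (x - 1) * rpow (1 - u) (y - 1)) 0 1.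

Lemma continuous_Beta_integrand (a b u : R) : 0 < a -> 0 < b ->
  continuous (fun u => rpow u a * rpow (1 - u) b) u.
Proof.
intros Ha Hb.
apply (continuous_mult (fun u => rpow u a) (fun u => rpow (1 - u) b)).
- apply continuous_rpow, Ha.
- apply continuous_rpow_comp; [exact Hb|apply continuous_one_minus].
Qed.

Lemma ex_RInt_cont (f : R -> R) (a b : R) : (forall x, continuous f x) -> ex_RInt f a b.
Proof. intros H. apply (ex_RInt_continuous f). intros z _; apply H. Qed.

(** Insert [1 = u + (1 - u)] into the integrand. *)
Lemma Beta_split (x y : R) : 1 < x -> 1 < y -> Beta x y = Beta (x + 1) y + Beta x (y + 1).
Proof.
intros Hx Hy. unfold Beta.
rewrite <- (RInt_plus (V := R_CompleteNormedModule)
  (fun u => rpow u (x + 1 - 1) * rpow (1 - u) (y - 1)))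
  by (apply ex_RInt_cont; intros; apply continuous_Beta_integrand; lra).
apply RInt_ext. intros u. rewrite Rmin_left, Rmax_right by lra. intros Hu.
change plus with Rplus.
replace (x + 1 - 1) with (x - 1 + 1) by ring. replace (y + 1 - 1) with (y - 1 + 1) by ring.
rewrite !rpow_plus, !rpow_1 by lra. Rring.
Qed.

(** The difference of the two sides is the integral of the derivative of [u^x (1-u)^y], which
    vanishes at both endpoints. *)
Lemma Beta_by_parts (x y : R) : 1 < x -> 1 < y -> x * Beta x (y + 1) = y * Beta (x + 1) y.
Proof.
intros Hx Hy.
assert (D : is_RInt (fun u => x * (rpow u (x - 1) * rpow (1 - u) (y + 1 - 1))
                       - y * (rpow u (x + 1 - 1) * rpow (1 - u) (y - 1))) 0 1
            (x * Beta x (y + 1) - y * Beta (x + 1) y)).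
{ apply (is_RInt_minus (V := R_NormedModule)
    (fun u => x * (rpow u (x - 1) * rpow (1 - u) (y + 1 - 1)))
    (fun u => y * (rpow u (x + 1 - 1) * rpow (1 - u) (y - 1)))).
  - apply (is_RInt_scal (V := R_NormedModule) (fun u => rpow u (x - 1) * rpow (1 - u) (y + 1 - 1))).
    apply (RInt_correct (V := R_CompleteNormedModule)), ex_RInt_cont; intros; apply continuous_Beta_integrand; lra.
  - apply (is_RInt_scal (V := R_NormedModule) (fun u => rpow u (x + 1 - 1) * rpow (1 - u) (y - 1))).
    apply (RInt_correct (V := R_CompleteNormedModule)), ex_RInt_cont; intros; apply continuous_Beta_integrand; lra. }
assert (F : is_RInt (fun u => x * (rpow u (x - 1) * rpow (1 - u) (y + 1 - 1))
                       - y * (rpow u (x + 1 - 1) * rpow (1 - u) (y - 1))) 0 1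
            (minus (rpow 1 x * rpow (1 - 1) y) (rpow 0 x * rpow (1 - 0) y))).
{ replace (y + 1 - 1) with y by ring. replace (x + 1 - 1) with x by ring.
  apply (is_RInt_derive (fun u => rpow u x * rpow (1 - u) y)).
  - intros u _.
    replace (x * (rpow u (x - 1) * rpow (1 - u) y) - y * (rpow u x * rpow (1 - u) (y - 1)))
      with (plus (mult (x * rpow u (x - 1)) (rpow (1 - u) y))
                 (mult (rpow u x) (- (y * rpow (1 - u) (y - 1)))))
      by (unfold plus, mult; simpl; ring).
    apply (is_derive_mult (fun u => rpow u x) (fun u => rpow (1 - u) y)).
    + apply is_derive_rpow, Hx.
    + apply is_derive_rpow_one_minus, Hy.
    + intros; apply Rmult_comm.
  - intros u _.
    apply (continuous_minus (V := R_NormedModule) (fun u => x * (rpow u (x - 1) * rpow (1 - u) y))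
      (fun u => y * (rpow u x * rpow (1 - u) (y - 1))));
    [apply (continuous_scal_r (V := R_NormedModule) x (fun u => rpow u (x - 1) * rpow (1 - u) y))
    |apply (continuous_scal_r (V := R_NormedModule) y (fun u => rpow u x * rpow (1 - u) (y - 1)))];
    apply continuous_Beta_integrand; lra. }
pose proof (is_RInt_unique _ _ _ _ D) as E.
rewrite (is_RInt_unique _ _ _ _ F) in E.
rewrite (rpow_nonpos (1 - 1)), (rpow_nonpos 0) in E by lra.
unfold minus, plus, opp in E; simpl in E. lra.
Qed.

Lemma Beta_succ (x y : R) : 1 < x -> 1 < y -> (x + y) * Beta (x + 1) y = x * Beta x y.
Proof.
intros Hx Hy. pose proof (Beta_by_parts x y Hx Hy). rewrite (Beta_split x y Hx Hy). lra.
Qed.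

(** Writing [u = 1 - (1 - u)] leaves two powers of [1 - u]. The value normalises [Beta_Gamma]; the
    more usual point [x = 1] is outside the range [x > 1]. *)
Lemma Beta_2 (y : R) : 1 < y -> Beta 2 y = / (y * (y + 1)).
Proof.
intros Hy.
assert (F : is_RInt (fun u => rpow (1 - u) (y - 1) - rpow (1 - u) (y + 1 - 1)) 0 1
  (minus (- (rpow (1 - 1) y / y) + rpow (1 - 1) (y + 1) / (y + 1))
         (- (rpow (1 - 0) y / y) + rpow (1 - 0) (y + 1) / (y + 1)))).
{ apply (is_RInt_derive (fun u => - (rpow (1 - u) y / y) + rpow (1 - u) (y + 1) / (y + 1))).
  - intros u _.
    pose proof (is_derive_rpow_one_minus y u Hy) as D1.
    pose proof (is_derive_rpow_one_minus (y + 1) u ltac:(lra)) as D2.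
    apply is_derive_ext with
      (fun u => plus (scal (- / y) (rpow (1 - u) y)) (scal (/ (y + 1)) (rpow (1 - u) (y + 1)))).
    { intros t. unfold plus, scal; simpl; unfold mult; simpl. field; lra. }
    replace (rpow (1 - u) (y - 1) - rpow (1 - u) (y + 1 - 1)) with
      (plus (scal (- / y) (- (y * rpow (1 - u) (y - 1))))
            (scal (/ (y + 1)) (- ((y + 1) * rpow (1 - u) (y + 1 - 1)))))
      by (unfold plus, scal; simpl; unfold mult; simpl; field; lra).
    apply (is_derive_plus (V := R_NormedModule)); apply is_derive_scal; assumption.
  - intros u _.
    apply (continuous_minus (V := R_NormedModule) (fun u => rpow (1 - u) (y - 1))
      (fun u => rpow (1 - u) (y + 1 - 1)));
    (apply continuous_rpow_comp; [lra|apply continuous_one_minus]). }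
unfold Beta.
rewrite (RInt_ext _ (fun u => rpow (1 - u) (y - 1) - rpow (1 - u) (y + 1 - 1))).
- rewrite (is_RInt_unique _ _ _ _ F).
  rewrite !(rpow_nonpos (1 - 1)), !Rminus_0_r, !rpow_1_l by lra.
  unfold minus, plus, opp; simpl. field; lra.
- intros u. rewrite Rmin_left, Rmax_right by lra. intros Hu.
  replace (2 - 1) with 1 by ring. replace (y + 1 - 1) with (y - 1 + 1) by ring.
  rewrite !rpow_plus, !rpow_1 by lra. Rring.
Qed.

Lemma Beta_antitone (x x' y : R) : 1 < x -> 1 < y -> x <= x' -> Beta x' y <= Beta x y.
Proof.
intros Hx Hy Hxx. apply RInt_le; [lra| | |].
- apply ex_RInt_cont; intros; apply continuous_Beta_integrand; lra.
- apply ex_RInt_cont; intros; apply continuous_Beta_integrand; lra.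
- intros u Hu. apply Rmult_le_compat_r; [apply rpow_ge_0|]. apply rpow_antitone; lra.
Qed.

(** Applying [Beta_succ] [N + 1] times produces the denominators of [gauss x N] and
    [gauss (x + y) N]; in their quotient the factorials cancel and the powers leave [N^y]. *)
Lemma Beta_gauss (x y : R) (N : nat) : 1 < x -> 1 < y -> (1 <= N)%nat ->
  Rpower (INR N) y * Beta (x + INR N + 1) y = Beta x y * gauss (x + y) N / gauss x N.
Proof.
intros Hx Hy HN.
assert (E : forall M, (x + y) * prod1 (fun k => x + y + INR k) M * Beta (x + INR M + 1) y =
            x * prod1 (fun k => x + INR k) M * Beta x y).
{ induction M as [|M IH].
  - simpl. rewrite Rplus_0_r, !Rmult_1_r. apply Beta_succ; assumption.
  - rewrite !prod1_S, S_INR. pose proof (pos_INR M).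
    pose proof (Beta_succ (x + INR M + 1) y ltac:(lra) Hy) as B.
    replace (x + (INR M + 1) + 1) with (x + INR M + 1 + 1) by ring.
    replace ((x + y) * (prod1 (fun k => x + y + INR k) M * (x + y + (INR M + 1))) *
      Beta (x + INR M + 1 + 1) y) with ((x + y) * prod1 (fun k => x + y + INR k) M *
      ((x + INR M + 1 + y) * Beta (x + INR M + 1 + 1) y)) by ring.
    rewrite B.
    replace (x * (prod1 (fun k => x + INR k) M * (x + (INR M + 1))) * Beta x y)
      with (x * prod1 (fun k => x + INR k) M * Beta x y * (x + INR M + 1)) by ring.
    rewrite <- IH. ring. }
specialize (E N). unfold gauss.
assert (0 < INR N) by (apply lt_0_INR; lia).
rewrite Rpower_plus.
pose proof (gauss_den_pos x N ltac:(lra)). pose proof (gauss_den_pos (x + y) N ltac:(lra)).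
pose proof (INR_fact_lt_0 N).
assert (0 < Rpower (INR N) x) by apply exp_pos.
replace (Beta (x + INR N + 1) y) with (x * prod1 (fun k => x + INR k) N * Beta x y /
   ((x + y) * prod1 (fun k => x + y + INR k) N)) by (rewrite <- E; field; split; lra).
field. repeat split; lra.
Qed.

(* The quotient [Beta x y * Gamma (x + y) / Gamma x] is 1-periodic in [x], and by
   [Beta_gauss] it is a limit of antitone functions of [x]: it is constant. *)
Lemma Beta_Gamma (x y : R) : 1 < x -> 1 < y -> Beta x y = Gamma x * Gamma y / Gamma (x + y).
Proof.
intros Hx Hy. pose (T := fun x => Beta x y * Gamma (x + y) / Gamma x).
assert (L : forall x, 1 < x ->
  is_lim_seq (fun N => Rpower (INR N) y * Beta (x + INR N + 1) y) (T x)).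
{ intros z Hz. apply is_lim_seq_ext_loc with (fun N => Beta z y * gauss (z + y) N / gauss z N).
  { exists 1%nat. intros N HN. symmetry; apply Beta_gauss; assumption. }
  apply is_lim_seq_div'.
  - apply (is_lim_seq_scal_l (gauss (z + y)) (Beta z y) (Gamma (z + y))).
    apply is_lim_gauss; lra.
  - apply is_lim_gauss; lra.
  - pose proof (Gamma_pos z ltac:(lra)). lra. }
assert (A : forall x x', 1 < x -> x <= x' -> T x' <= T x).
{ intros z z' Hz Hzz.
  refine (is_lim_seq_le _ _ (T z') (T z) _ (L z' ltac:(lra)) (L z Hz)).
  intros N. apply Rmult_le_compat_l; [left; apply exp_pos|].
  pose proof (pos_INR N). apply Beta_antitone; lra. }
assert (P : forall z m, 1 < z -> T (z + INR m) = T z).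
{ intros z m Hz. induction m as [|m IH]; [simpl; rewrite Rplus_0_r; reflexivity|].
  rewrite <- IH, S_INR. pose proof (pos_INR m). set (v := z + INR m).
  replace (z + (INR m + 1)) with (v + 1) by (unfold v; ring).
  assert (1 < v) by (unfold v; lra). unfold T.
  replace (v + 1 + y) with (v + y + 1) by ring. rewrite !Gamma_succ by lra.
  pose proof (Gamma_pos v ltac:(lra)). pose proof (Beta_succ v y ltac:(lra) Hy) as B.
  replace (Beta (v + 1) y * ((v + y) * Gamma (v + y)) / (v * Gamma v))
    with ((v + y) * Beta (v + 1) y * Gamma (v + y) / (v * Gamma v)) by (field; lra).
  rewrite B. field; lra. }
assert (C : forall z z', 1 < z -> z <= z' -> T z = T z').
{ intros z z' Hz Hzz. apply Rle_antisym; [|apply A; assumption].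
  (* For [z' <= z + m], periodicity and antitonicity give [T z = T (z + m) <= T z']. *)
  destruct (INR_unbounded (z' - z)) as [m Hm].
  rewrite <- (P z m Hz). apply A; lra. }
assert (E : T x = Gamma y).
{ transitivity (T 2).
  - destruct (Rle_dec x 2); [apply C|symmetry; apply C]; lra.
  - unfold T. rewrite Beta_2 by assumption.
    replace (2 + y) with (y + 1 + 1) by ring. replace 2 with (1 + 1) by ring.
    rewrite !Gamma_succ, Gamma_1 by lra. field. lra. }
pose proof (Gamma_pos x ltac:(lra)). pose proof (Gamma_pos (x + y) ltac:(lra)).
rewrite <- E. unfold T. field. split; lra.
Qed.

(** Substitute [u = sin t ^ 2]. The point [(3/2, 3/2)] replaces [(1/2, 1/2)], where the integrand is
    unbounded; the recurrence of [Gamma] then leads back to [Gamma (1/2)]. *)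
Lemma Beta_half : Beta (3/2) (3/2) = PI / 8.
Proof.
pose (f := fun u => rpow u (3/2 - 1) * rpow (1 - u) (3/2 - 1)).
assert (S : is_RInt (fun t => scal (2 * sin t * cos t) (f (sin t ^ 2))) 0 (PI/2)
   (RInt f (sin 0 ^ 2) (sin (PI/2) ^ 2))).
{ apply (is_RInt_comp (V := R_CompleteNormedModule) f (fun t => sin t ^ 2)).
  - intros; apply continuous_Beta_integrand; lra.
  - intros t _. split.
    + auto_derive; [exact I|ring].
    + apply (ex_derive_continuous (fun t => 2 * sin t * cos t)). auto_derive. exact I. }
assert (F : is_RInt (fun t => 2 * sin t ^ 2 * cos t ^ 2) 0 (PI/2)
   (minus (PI/2/4 - sin (4 * (PI/2)) / 16) (0/4 - sin (4 * 0) / 16))).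
{ apply (is_RInt_derive (fun t => t / 4 - sin (4 * t) / 16)).
  - intros t _. auto_derive; [exact I|].
    replace (4 * t) with (2 * (2 * t)) by ring. rewrite cos_2a_sin, sin_2a. field.
  - intros t _. apply (ex_derive_continuous (fun t => 2 * sin t ^ 2 * cos t ^ 2)).
    auto_derive. exact I. }
assert (Q : forall v, 0 < v -> rpow (v ^ 2) (3/2 - 1) = v).
{ intros v Hv. replace (v ^ 2) with (v * v) by ring. rewrite rpow_mult_distr, rpow_pos by assumption.
  rewrite <- Rpower_plus. replace (3/2 - 1 + (3/2 - 1)) with 1 by field. apply Rpower_1, Hv. }
rewrite sin_0, sin_PI2 in S.
replace (0 ^ 2) with 0 in S by ring. replace (1 ^ 2) with 1 in S by ring.
unfold Beta. fold f. rewrite <- (is_RInt_unique _ _ _ _ S).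
pose proof PI_RGT_0.
rewrite (RInt_ext _ (fun t => 2 * sin t ^ 2 * cos t ^ 2)).
- rewrite (is_RInt_unique _ _ _ _ F).
  replace (4 * (PI/2)) with (0 + 2 * INR 1 * PI) by (simpl; field).
  rewrite sin_period, Rmult_0_r, sin_0. unfold minus, plus, opp; simpl. field.
- intros t. rewrite Rmin_left, Rmax_right by lra. intros Ht.
  assert (0 < sin t) by (apply sin_gt_0; lra). assert (0 < cos t) by (apply cos_gt_0; lra).
  unfold f, scal; simpl; unfold mult; simpl. fold (sin t ^ 2).
  change (sin t * (sin t * 1)) with (sin t ^ 2).
  replace (1 - sin t ^ 2) with (cos t ^ 2).
  + rewrite !Q by assumption. ring.
  + pose proof (sin2_cos2 t) as h. unfold Rsqr in h. lra.
Qed.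

Lemma Gamma_half_sqr : Gamma (1/2) ^ 2 = PI.
Proof.
pose proof Beta_half as B. rewrite Beta_Gamma in B by lra.
replace (3/2 + 3/2) with (1 + 1 + 1) in B by field.
replace (3/2) with (1/2 + 1) in B by field.
rewrite !Gamma_succ, Gamma_1 in B by lra. lra.
Qed.

(** * The Barnes function *)

Ltac min_cases := unfold Rmin, Rmax in *; repeat
  match goal with
  | |- context [Rle_dec ?a ?b] => destruct (Rle_dec a b)
  | H : context [Rle_dec ?a ?b] |- _ => destruct (Rle_dec a b)
  end.

Lemma is_lim_gammaE :
  is_lim_seq (fun n => sum_f_R0 (fun k => / INR (S k)) n - ln (INR (S n))) gammaE.
Proof.
destruct (ex_lim_seq_of_quadratic_steps
  (fun n => sum_f_R0 (fun k => / INR (S k)) n - ln (INR (S n))) 1) as [l Hl].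
- intros n. pose proof (pos_INR n). cbn [sum_f_R0]. rewrite !S_INR.
  pose proof (ln_diff_bounds (INR n + 1) (INR n + 1 + 1) ltac:(lra) ltac:(lra)) as [A1 A2].
  replace (INR n + 1 + 1) with (INR n + 2) in * by ring.
  replace ((INR n + 2 - (INR n + 1)) / (INR n + 2)) with (/ (INR n + 2)) in A1 by (field; lra).
  replace ((INR n + 2 - (INR n + 1)) / (INR n + 1)) with (/ (INR n + 1)) in A2 by (field; lra).
  replace (1 / ((INR n + 1) * (INR n + 2))) with (/ (INR n + 1) - / (INR n + 2)) by (field; lra).
  apply Rabs_le. lra.
- unfold gammaE. rewrite (lim_seq_eq _ _ Hl). exact Hl.
Qed.

(** Mean value theorem, the derivative of the left side being [v^2 / (1 + v)]. The condition
    [Rmin 0 x <= u] admits every [u = x/k] with [k >= 1], whatever the sign of [x], with a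
    denominator independent of [k]. *)
Lemma ln_taylor_bound (x u : R) : -1 < x -> Rmin 0 x <= u ->
  Rabs (ln (1 + u) - u + u ^ 2 / 2) <= Rabs u ^ 3 / Rmin 1 (1 + x).
Proof.
intros Hx Hu.
assert (M : -1 < Rmin 0 x) by (apply Rmin_glb_lt; lra).
destruct (MVT_gen (fun v => ln (1 + v) - v + v ^ 2 / 2) 0 u (fun v => v ^ 2 / (1 + v)))
  as [c [Hc Ec]].
- intros v Hv. assert (-1 < v) by (min_cases; lra).
  auto_derive; [lra|]. field. lra.
- intros v Hv. assert (-1 < v) by (min_cases; lra).
  apply continuity_pt_filterlim.
  apply (ex_derive_continuous (fun v => ln (1 + v) - v + v ^ 2 / 2)). auto_derive. lra.
- rewrite Rplus_0_r, ln_1 in Ec.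
  replace (ln (1 + u) - u + u ^ 2 / 2) with (c ^ 2 / (1 + c) * u)
    by (rewrite (Rminus_0_r u) in Ec; rewrite <- Ec; field).
  assert (Hc1 : Rmin 1 (1 + x) <= 1 + c).
  { min_cases; lra. }
  assert (Hm : 0 < Rmin 1 (1 + x)) by (apply Rmin_glb_lt; lra).
  assert (Hcu : c ^ 2 <= Rabs u ^ 2).
  { rewrite pow2_abs. min_cases; nra. }
  rewrite Rabs_mult, Rabs_pos_eq.
  + replace (Rabs u ^ 3 / Rmin 1 (1 + x)) with (Rabs u ^ 2 / Rmin 1 (1 + x) * Rabs u)
      by (field; lra).
    apply Rmult_le_compat_r; [apply Rabs_pos|].
    apply Rmult_le_compat; [apply pow2_ge_0|left; apply Rinv_0_lt_compat; lra|exact Hcu|].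
    apply Rinv_le_contravar; assumption.
  + apply Rmult_le_pos; [apply pow2_ge_0|left; apply Rinv_0_lt_compat; lra].
Qed.

Definition barnes_prod (x : R) (N : nat) : R :=
  prod1 (fun k => (1 + x / INR k) ^ k * exp (- x + x ^ 2 / (2 * INR k))) N.

Lemma barnes_base_pos (x : R) (k : nat) : -1 < x -> 0 < 1 + x / INR (S k).
Proof.
intros Hx. rewrite S_INR. pose proof (pos_INR k).
replace (1 + x / (INR k + 1)) with ((INR k + 1 + x) / (INR k + 1)) by (field; lra).
apply Rdiv_lt_0_compat; lra.
Qed.

Lemma barnes_prod_pos (x : R) (N : nat) : -1 < x -> 0 < barnes_prod x N.
Proof.
intros Hx. apply prod1_pos. intros k. apply Rmult_lt_0_compat; [|apply exp_pos].
apply pow_lt, barnes_base_pos, Hx.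
Qed.

Lemma ln_barnes_step (x : R) (n : nat) : -1 < x ->
  ln (barnes_prod x (S n)) = ln (barnes_prod x n) +
   ((INR n + 1) * ln (1 + x / (INR n + 1)) - x + x ^ 2 / (2 * (INR n + 1))).
Proof.
intros Hx. pose proof (barnes_prod_pos x n Hx). pose proof (barnes_base_pos x n Hx) as B.
unfold barnes_prod. rewrite prod1_S. fold (barnes_prod x n).
assert (0 < (1 + x / INR (S n)) ^ S n) by (apply pow_lt, B).
rewrite ln_mult by (try apply Rmult_lt_0_compat; try apply exp_pos; assumption).
rewrite ln_mult by (try apply exp_pos; assumption).
rewrite ln_exp, ln_pow, S_INR by assumption. ring.
Qed.

(** The exponential factors cancel the first two Taylor terms of [k ln (1 + x/k)], so the increments
    are [O(1/k^2)]. The 2 in the constant comes from [1/k^2 <= 2/(k(k+1))]. *)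
Lemma is_lim_ln_barnes (x : R) : -1 < x ->
  is_lim_seq (fun n => ln (barnes_prod x n)) (ln (lim_seq (barnes_prod x))) /\
  0 < lim_seq (barnes_prod x).
Proof.
intros Hx. set (m := Rmin 1 (1 + x)).
assert (Hm : 0 < m) by (apply Rmin_glb_lt; lra).
destruct (ex_lim_seq_of_quadratic_steps (fun n => ln (barnes_prod x n))
  (2 * (Rabs x ^ 3 / m))) as [l Hl].
- intros n. rewrite ln_barnes_step by assumption. pose proof (pos_INR n).
  set (k := INR n + 1). assert (1 <= k) by (unfold k; lra).
  replace (INR n + 2) with (k + 1) by (unfold k; ring).
  assert (Hu : Rmin 0 x <= x / k).
  { apply Rmult_le_reg_r with k; [lra|]. replace (x / k * k) with x by (field; lra).
    min_cases; nra. }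
  pose proof (ln_taylor_bound x (x / k) Hx Hu) as T. fold m in T.
  replace (ln (barnes_prod x n) + (k * ln (1 + x / k) - x + x ^ 2 / (2 * k))
     - ln (barnes_prod x n)) with (k * (ln (1 + x / k) - x / k + (x / k) ^ 2 / 2))
    by (field; lra).
  rewrite Rabs_mult, (Rabs_pos_eq k) by lra.
  apply Rle_trans with (k * (Rabs (x / k) ^ 3 / m)); [apply Rmult_le_compat_l; lra|].
  rewrite Rabs_div, (Rabs_pos_eq k) by lra.
  assert (0 <= Rabs x ^ 3 / m).
  { apply Rmult_le_pos; [apply pow_le, Rabs_pos|left; apply Rinv_0_lt_compat, Hm]. }
  replace (k * ((Rabs x / k) ^ 3 / m)) with (Rabs x ^ 3 / m * / (k * k)) by (field; lra).
  replace (2 * (Rabs x ^ 3 / m) / (k * (k + 1))) with (Rabs x ^ 3 / m * (2 / (k * (k + 1))))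
    by (field; lra).
  apply Rmult_le_compat_l; [assumption|].
  apply Rmult_le_reg_r with (k * k * (k + 1)); [nra|].
  replace (/ (k * k) * (k * k * (k + 1))) with (k + 1) by (field; lra).
  replace (2 / (k * (k + 1)) * (k * k * (k + 1))) with (2 * k) by (field; lra). lra.
- assert (L : lim_seq (barnes_prod x) = exp l).
  { apply lim_seq_eq. apply is_lim_seq_ext with (fun n => exp (ln (barnes_prod x n))).
    - intros n; apply exp_ln, barnes_prod_pos, Hx.
    - apply is_lim_seq_continuous; [apply derivable_continuous_pt, derivable_pt_exp|exact Hl]. }
  rewrite L, ln_exp. split; [exact Hl|apply exp_pos].
Qed.

Lemma BarnesG_exp (x : R) : -1 < x ->
  BarnesG (x + 1) = exp (x / 2 * ln (2 * PI) - (1/2) * x * (x + 1) - (1/2) * gammaE * x ^ 2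
                         + ln (lim_seq (barnes_prod x))).
Proof.
intros Hx. unfold BarnesG. replace (x + 1 - 1) with x by ring.
fold (barnes_prod x). change (fun N => barnes_prod x N) with (barnes_prod x).
rewrite <- (exp_ln (lim_seq (barnes_prod x))) at 1 by apply is_lim_ln_barnes, Hx.
unfold Rpower. rewrite <- !exp_plus. f_equal. ring.
Qed.

Lemma BarnesG_pos (y : R) : 0 < y -> 0 < BarnesG y.
Proof.
intros Hy. replace y with (y - 1 + 1) by ring. rewrite BarnesG_exp by lra. apply exp_pos.
Qed.

Lemma BarnesG_1 : BarnesG 1 = 1.
Proof.
replace 1 with (0 + 1) at 1 by ring. rewrite BarnesG_exp by lra.
assert (L : lim_seq (barnes_prod 0) = 1).
{ apply lim_seq_eq. apply is_lim_seq_ext with (fun _ => 1); [|apply is_lim_seq_const].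
  intros n. unfold barnes_prod. rewrite (prod1_ext _ (fun _ => 1)), prod1_const, pow1; [reflexivity|].
  intros k. unfold Rdiv. rewrite !Rmult_0_l, Rplus_0_r, pow1.
  replace (- 0 + 0 ^ 2 * / (2 * INR (S k))) with 0 by ring. rewrite exp_0. ring. }
rewrite L, ln_1, <- exp_0. f_equal. field.
Qed.

Lemma is_lim_succ_mul_ln (x : R) : 0 < x ->
  is_lim_seq (fun n => (INR n + 2) * (ln (x + INR n + 1) - ln (INR n + 1))) x.
Proof.
intros Hx.
apply is_lim_seq_le_le with (fun n => x * ((INR n + 2) / (INR n + (x + 1))))
  (fun n => x * ((INR n + 2) / (INR n + 1))).
- intros n. pose proof (pos_INR n).
  pose proof (ln_diff_bounds (INR n + 1) (x + INR n + 1) ltac:(lra) ltac:(lra)) as [A B].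
  split.
  + replace (x * ((INR n + 2) / (INR n + (x + 1))))
      with ((INR n + 2) * ((x + INR n + 1 - (INR n + 1)) / (x + INR n + 1))) by (field; lra).
    apply Rmult_le_compat_l; lra.
  + replace (x * ((INR n + 2) / (INR n + 1)))
      with ((INR n + 2) * ((x + INR n + 1 - (INR n + 1)) / (INR n + 1))) by (field; lra).
    apply Rmult_le_compat_l; lra.
- replace (Finite x) with (Finite (x * 1)) by (f_equal; ring).
  apply (is_lim_seq_scal_l _ x 1), is_lim_seq_ratio.
- replace (Finite x) with (Finite (x * 1)) by (f_equal; ring).
  apply (is_lim_seq_scal_l _ x 1), is_lim_seq_ratio.
Qed.

(** With [N = n + 1], the logarithm of Stirling's quotient [N^(N+1/2) e^(-N) / N!]; it is the part
    of [ln_barnes_shift] free of [x]. *)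
Definition stirling_log (n : nat) : R :=
  (INR n + 3/2) * ln (INR n + 1) - (INR n + 1) - ln (INR (fact (S n))).

(** With [N = n + 1], the product of [((x+k)/(x+k-1))^k] over [1 <= k <= N] telescopes to
    [(x+N)^(N+1)] over [x (x+1) ... (x+N)], the denominator of [gauss x N]. The exponential factors
    contribute [-1 + (x - 1/2)/k] each, whence the harmonic sum. *)
Lemma ln_barnes_shift (x : R) (n : nat) : 0 < x ->
  ln (barnes_prod x (S n)) - ln (barnes_prod (x - 1) (S n)) =
  ln (gauss x (S n)) + (INR n + 2) * (ln (x + INR n + 1) - ln (INR n + 1)) + stirling_log n
  + (x - 1/2) * (sum_f_R0 (fun k => / INR (S k)) n - ln (INR (S n))).
Proof.
intros Hx.
assert (Q : forall m z, -1 < z -> ln (1 + z / (INR m + 1)) = ln (z + INR m + 1) - ln (INR m + 1)).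
{ intros m z Hz. pose proof (pos_INR m). rewrite <- ln_div by lra. f_equal. field. lra. }
induction n as [|n IH].
- rewrite !ln_barnes_step, !Q, ln_gauss by lra. unfold stirling_log, barnes_prod. simpl.
  rewrite !Rplus_0_l, !Rplus_0_r, ln_1, !Rmult_1_l, Rinv_1.
  replace (x - 1 + 1) with x by ring. field.
- rewrite ln_barnes_step, (ln_barnes_step (x - 1)), !Q by lra. cbn [sum_f_R0].
  pose proof (ln_gauss_step x n Hx) as G. unfold stirling_log in *.
  change (fact (S (S n))) with (S (S n) * fact (S n))%nat.
  pose proof (INR_fact_lt_0 (S n)). pose proof (pos_INR n).
  rewrite mult_INR, !S_INR in *. rewrite ln_mult by lra.
  replace (INR n + 1 + 1) with (INR n + 2) in * by ring.
  replace (x + (INR n + 1) + 1) with (x + INR n + 2) in * by ring.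
  replace (x - 1 + (INR n + 1) + 1) with (x + INR n + 1) in * by ring.
  replace (ln (gauss x (S (S n)))) with (ln (gauss x (S n)) + (x * (ln (INR n + 2) - ln (INR n + 1)) - (ln (x + INR n + 2) - ln (INR n + 2)))) by lra.
  match goal with |- ?L = ?R => cut (L - R = 0); [lra|] end.
  match type of IH with ?L = ?R => assert (IH' : L - R = 0) by lra end.
  rewrite <- IH'. field. lra.
Qed.

(* The constant is 1 by Stirling's formula, but it cancels from [Cconst], so only
   its independence of [y] matters. *)
Lemma BarnesG_succ : exists kappa, 0 < kappa /\
  forall y, 0 < y -> BarnesG (y + 1) = kappa * Gamma y * BarnesG y.
Proof.
pose (lp := fun x => ln (lim_seq (barnes_prod x))).
(* The limit of [stirling_log] as computed from [ln_barnes_shift] at [x]; the sequence is free of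
   [x], hence [r] is constant on [x > 0]. *)
pose (r := fun x => lp x - lp (x - 1) - ln (Gamma x) - x - (x - 1/2) * gammaE).
assert (L : forall x, 0 < x -> is_lim_seq stirling_log (r x)).
{ intros x Hx.
  apply is_lim_seq_ext with (fun n =>
    ln (barnes_prod x (S n)) - ln (barnes_prod (x - 1) (S n)) - ln (gauss x (S n))
    - (INR n + 2) * (ln (x + INR n + 1) - ln (INR n + 1))
    - (x - 1/2) * (sum_f_R0 (fun k => / INR (S k)) n - ln (INR (S n)))).
  { intros n. rewrite ln_barnes_shift by assumption. ring. }
  repeat apply is_lim_seq_minus'.
  - apply (is_lim_seq_incr_1 (fun n => ln (barnes_prod x n))), is_lim_ln_barnes; lra.
  - apply (is_lim_seq_incr_1 (fun n => ln (barnes_prod (x - 1) n))), is_lim_ln_barnes; lra.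
  - apply (is_lim_seq_incr_1 (fun n => ln (gauss x n))).
    apply is_lim_seq_continuous; [|apply is_lim_gauss, Hx].
    apply derivable_continuous_pt. exists (/ Gamma x). apply derivable_pt_lim_ln, Gamma_pos, Hx.
  - apply is_lim_succ_mul_ln, Hx.
  - apply (is_lim_seq_scal_l _ (x - 1/2) gammaE), is_lim_gammaE. }
(* In the quotient of the prefactors of [BarnesG], [-y] and [-(y - 1/2) gammaE] cancel against
   [r y]; [ln (2 * PI) / 2] comes from the power of [2 * PI]. *)
exists (exp (ln (2 * PI) / 2 + r 1)). split; [apply exp_pos|]. intros y Hy.
assert (E : r 1 = r y).
{ pose proof (is_lim_seq_unique _ _ (L y Hy)) as E.
  rewrite (is_lim_seq_unique _ _ (L 1 ltac:(lra))) in E. injection E as E. exact E. }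
rewrite E, BarnesG_exp by lra. replace (BarnesG y) with (BarnesG (y - 1 + 1)) by (f_equal; ring).
rewrite BarnesG_exp by lra. rewrite <- (exp_ln (Gamma y)) at 1 by apply Gamma_pos, Hy.
rewrite <- !exp_plus. f_equal. unfold r, lp. field.
Qed.

(** The squared norm of the monic Jacobi polynomial of degree [j] for [u^a (1-u)^b] on [0,1], that
    is, the quotient of two consecutive Hankel determinants. *)
Definition selberg_factor (a b : R) (j : nat) : R :=
  Gamma (INR j + 1) * Gamma (INR j + a + 1) * Gamma (INR j + b + 1) * Gamma (INR j + a + b + 1)
  / (Gamma (2 * INR j + a + b + 1) * Gamma (2 * INR j + a + b + 2)).

(** Passing from [n] to [n + 1], the four Barnes values above and the two squared ones below
    contribute [kappa^4] each, which cancels. The isolated Gamma value in the denominator lets the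
    half-integer shifts pair up as [Gamma A Gamma B] and [Gamma B Gamma (A + 1)], with
    [B = A + 1/2]: duplication applies to both pairs. *)
Lemma Cconst_prod (a b : R) (n : nat) : 0 < a -> 0 < b ->
  Cconst a b n = prod1 (fun i => selberg_factor a b (Nat.pred i)) n.
Proof.
intros Ha Hb. destruct BarnesG_succ as [kappa [Hk HG]].
assert (PG := BarnesG_pos). assert (PGa := Gamma_pos). pose proof PI_RGT_0.
induction n as [|n IH].
- unfold Cconst. simpl. rewrite !Rplus_0_l, Rmult_0_r, Rmult_0_l, Ropp_0, Rpower_O, BarnesG_1 by lra.
  field. repeat split; apply Rgt_not_eq; (apply PG || apply PGa); lra.
- rewrite prod1_S, <- IH. clear IH. unfold Cconst, selberg_factor. simpl Nat.pred.
  rewrite S_INR. pose proof (pos_INR n). set (N := INR n) in *.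
  replace (N + 1 + a + b + 1) with (N + a + b + 1 + 1) by ring.
  replace (N + 1 + a + 1) with (N + a + 1 + 1) by ring.
  replace (N + 1 + b + 1) with (N + b + 1 + 1) by ring.
  replace (N + 1 + (a + b + 1) / 2) with (N + (a + b + 1) / 2 + 1) by ring.
  replace (N + 1 + (a + b) / 2 + 1) with (N + (a + b) / 2 + 1 + 1) by ring.
  rewrite (HG (N + 1)), (HG (N + a + 1)), (HG (N + b + 1)), (HG (N + a + b + 1)),
    (HG (N + (a + b + 1) / 2)), (HG (N + (a + b) / 2 + 1)) by lra.
  (* The new power of 2 is split into the two that duplication yields at [A] and [B], with one
     factor 2 left over. *)
  replace (Rpower 2 (- (2 * (N + 1) * (N + 1 + a + b)))) with
    (Rpower 2 (- (2 * N * (N + a + b))) * Rpower 2 (- (2 * (N + (a + b + 1) / 2)))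
     * Rpower 2 (- (2 * (N + (a + b) / 2 + 1))) * Rpower 2 1).
  2:{ rewrite <- !Rpower_plus. f_equal. field. }
  rewrite (Rpower_1 2) by lra.
  pose proof (Gamma_duplication (N + (a + b + 1) / 2) ltac:(lra)) as D1.
  pose proof (Gamma_duplication (N + (a + b) / 2 + 1) ltac:(lra)) as D2.
  replace (N + (a + b + 1) / 2 + 1 / 2) with (N + (a + b) / 2 + 1) in D1 by field.
  replace (N + (a + b) / 2 + 1 + 1 / 2) with (N + (a + b + 1) / 2 + 1) in D2 by field.
  replace (2 * N + a + b + 1) with (2 * (N + (a + b + 1) / 2)) by field.
  replace (2 * N + a + b + 2) with (2 * (N + (a + b) / 2 + 1)) by field.
  set (A := N + (a + b + 1) / 2) in *. set (B := N + (a + b) / 2 + 1) in *.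
  set (P1 := Rpower 2 (- (2 * A))) in *. set (P2 := Rpower 2 (- (2 * B))) in *.
  assert (0 < P1) by apply exp_pos. assert (0 < P2) by apply exp_pos.
  assert (0 < A) by (unfold A; lra). assert (0 < B) by (unfold B; lra).
  pose proof (PGa A ltac:(lra)). pose proof (PGa B ltac:(lra)). pose proof (PGa (A + 1) ltac:(lra)).
  pose proof (PGa (2 * A) ltac:(lra)). pose proof (PGa (2 * B) ltac:(lra)).
  pose proof (PGa (1/2) ltac:(lra)). pose proof Gamma_half_sqr as HP.
  (* Each duplication brings [2 * Gamma (1/2)], together [4 * PI]: this is the new factor [2 * PI]
     times the 2 left over. *)
  assert (E : forall v, v / (Gamma (2 * A) * Gamma (2 * B)) =
     v * (4 * PI * P1 * P2) / (Gamma A * Gamma B * (Gamma B * Gamma (A + 1)))).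
  { intros v. rewrite D1, D2, <- HP. field. repeat split; lra. }
  rewrite E, <- tech_pow_Rmult.
  field. repeat split; apply Rgt_not_eq; try assumption; (apply PG || apply PGa); lra.
Qed.

(** * Hankel determinants of Beta integrals *)

(** Shaped for the induction in [detn_Gamma_quotient]: the coefficient is the row factor times the
    column factor of index [j] extracted there. *)
Lemma selberg_factor_succ (a b : R) (j : nat) : 0 < a -> 0 < b ->
  selberg_factor a b (S j) / Gamma (b + 1) =
  (INR j + 1) * (b + 1) * / (a + b + 2 + INR j)
  * (selberg_factor (a + 1) (b + 1) j / Gamma (b + 1 + 1)).
Proof.
intros Ha Hb. unfold selberg_factor. rewrite S_INR. pose proof (pos_INR j). set (J := INR j) in *.
assert (PG := Gamma_pos).
rewrite !(Gamma_succ (J + 1)), (Gamma_succ (b + 1)) by lra.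
replace (J + 1 + a + 1) with (J + (a + 1) + 1) by ring.
replace (J + 1 + b + 1) with (J + (b + 1) + 1) by ring.
replace (J + (a + 1) + (b + 1) + 1) with (J + 1 + a + b + 1 + 1) by ring.
rewrite (Gamma_succ (J + 1 + a + b + 1)) by lra.
replace (2 * (J + 1) + a + b + 1) with (2 * J + (a + 1) + (b + 1) + 1) by ring.
replace (2 * (J + 1) + a + b + 2) with (2 * J + (a + 1) + (b + 1) + 2) by ring.
field. repeat split; apply Rgt_not_eq; try apply PG; lra.
Qed.

(* One column reduction sends the parameters [(a, b)] to [(a+1, b+1)]. *)
Lemma detn_Gamma_quotient (n : nat) (a b : R) : 0 < a -> 0 < b ->
  detn n (fun i j => Gamma (a + 1 + INR (i + j)) / Gamma (a + b + 2 + INR (i + j))) =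
  prod1 (fun i => selberg_factor a b (Nat.pred i) / Gamma (b + 1)) n.
Proof.
assert (PG := Gamma_pos).
revert a b; induction n as [|n IH]; intros a b Ha Hb; [reflexivity|].
assert (GA : forall k, 0 <= k -> Gamma (a + 1 + (k + 1)) = (a + 1 + k) * Gamma (a + 1 + k)).
{ intros k Hk. rewrite <- Gamma_succ by lra. f_equal; ring. }
assert (GC : forall k, 0 <= k ->
  Gamma (a + b + 2 + (k + 1)) = (a + b + 2 + k) * Gamma (a + b + 2 + k)).
{ intros k Hk. rewrite <- Gamma_succ by lra. f_equal; ring. }
(* The multipliers are the ratios of neighbouring entries of the first row. *)
rewrite (detn_column_reduction n (fun j => (a + 1 + INR j) / (a + b + 2 + INR j))).
2:{ intros j. cbv beta. pose proof (pos_INR j). rewrite !Nat.add_0_l, S_INR, GA, GC by lra.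
    field. split; apply Rgt_not_eq; try apply PG; lra. }
(* Subtracting the values of [(a+1+k)/(a+b+2+k)] at [k = j] from those at [k = i+j+1] gives the
   numerator [(i+1)(b+1)], free of [j]; the entry thus splits into a row factor, a column factor and
   an entry for [(a+1, b+1)]. *)
rewrite (eq_detn n _ (fun i j => (INR i + 1) * (b + 1) * / (a + b + 2 + INR j) *
   (Gamma (a + 1 + 1 + INR (i + j)) / Gamma (a + 1 + (b + 1) + 2 + INR (i + j))))).
- rewrite (detn_scal n (fun i => (INR i + 1) * (b + 1)) (fun j => / (a + b + 2 + INR j))).
  rewrite IH, prod1_head, <- !prod1_mult by lra. f_equal.
  + unfold selberg_factor. simpl. rewrite Rmult_0_r, !Rplus_0_l, !Rplus_0_r, Gamma_1.
    field. repeat split; apply Rgt_not_eq; apply PG; lra.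
  + apply prod1_ext. intros k. simpl Nat.pred. symmetry. apply selberg_factor_succ; assumption.
- intros i j _ _. pose proof (pos_INR i). pose proof (pos_INR j).
  replace (S i + S j)%nat with (S (S (i + j))) by lia.
  replace (S i + j)%nat with (S (i + j)) by lia.
  rewrite !S_INR, plus_INR. set (I := INR i) in *. set (J := INR j) in *.
  replace (a + 1 + 1 + (I + J)) with (a + 1 + (I + J + 1)) by ring.
  replace (a + 1 + (b + 1) + 2 + (I + J)) with (a + b + 2 + (I + J + 1 + 1)) by ring.
  rewrite (GA (I + J + 1)), (GC (I + J + 1)) by lra.
  field. repeat split; apply Rgt_not_eq; try apply PG; lra.
Qed.

Lemma detn_Beta (n : nat) (a b : R) : 0 < a -> 0 < b ->
  detn n (fun i j => Beta (a + INR (i + j) + 1) (b + 1)) = Cconst a b n.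
Proof.
intros Ha Hb. assert (PG := Gamma_pos).
rewrite (eq_detn n _ (fun i j => Gamma (b + 1) * 1 *
  (Gamma (a + 1 + INR (i + j)) / Gamma (a + b + 2 + INR (i + j))))).
- rewrite (detn_scal n (fun _ => Gamma (b + 1)) (fun _ => 1)).
  rewrite detn_Gamma_quotient, Cconst_prod, <- !prod1_mult by assumption.
  apply prod1_ext. intros k. field. apply Rgt_not_eq, PG; lra.
- intros i j _ _. pose proof (pos_INR (i + j)). rewrite Beta_Gamma by lra.
  replace (a + INR (i + j) + 1 + (b + 1)) with (a + b + 2 + INR (i + j)) by ring.
  replace (a + INR (i + j) + 1) with (a + 1 + INR (i + j)) by ring.
  field. apply Rgt_not_eq, PG; lra.
Qed.

Lemma Cconst_pos (a b : R) (n : nat) : 0 < a -> 0 < b -> 0 < Cconst a b n.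
Proof.
intros Ha Hb. assert (PG := Gamma_pos). rewrite Cconst_prod by assumption. apply prod1_pos.
intros k. simpl Nat.pred. pose proof (pos_INR k). unfold selberg_factor.
apply Rdiv_lt_0_compat; repeat apply Rmult_lt_0_compat; apply PG; lra.
Qed.

(** * Moments of affine functions *)

Fixpoint affine_pow_coef (c d : R) (i p : nat) : R :=
  match i, p with
  | O, O => 1
  | O, S _ => 0
  | S i', O => c * affine_pow_coef c d i' O
  | S i', S p' => c * affine_pow_coef c d i' (S p') + d * affine_pow_coef c d i' p'
  end.

Lemma affine_pow_coef_gt (c d : R) (i p : nat) : (i < p)%nat -> affine_pow_coef c d i p = 0.
Proof.
revert p; induction i as [|i IH]; intros [|p] H; simpl; try lia; [reflexivity|].
rewrite !IH by lia. ring.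
Qed.

Lemma affine_pow_coef_diag (c d : R) (i : nat) : affine_pow_coef c d i i = d ^ i.
Proof.
induction i as [|i IH]; simpl; [reflexivity|]. rewrite IH, affine_pow_coef_gt by lia. ring.
Qed.

(** The coefficients vanish beyond [i], so the sum may run to any [m >= i]; one common bound for all
    rows is what the matrix factorisation requires. *)
Lemma affine_pow_expand (c d u : R) (i m : nat) : (i <= m)%nat ->
  (c + d * u) ^ i = sum_f_R0 (fun p => affine_pow_coef c d i p * u ^ p) m.
Proof.
revert m; induction i as [|i IH]; intros m H.
- destruct m as [|m]; [simpl; ring|]. rewrite decomp_sum by lia. simpl.
  rewrite (sum_eq _ (fun _ => 0)) by (intros; ring). rewrite sum_cte. ring.
- destruct m as [|m]; [lia|]. rewrite decomp_sum by lia. simpl Nat.pred.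
  rewrite (sum_eq _ (fun p => affine_pow_coef c d i (S p) * u ^ S p * c
     + affine_pow_coef c d i p * u ^ p * (d * u))) by (intros; simpl; ring).
  rewrite plus_sum, <- !scal_sum, <- tech_pow_Rmult, <- (IH m) by lia.
  assert (E := IH (S m) ltac:(lia)). rewrite decomp_sum in E by lia. simpl Nat.pred in E.
  rewrite Rmult_plus_distr_r. rewrite E at 1. simpl. ring.
Qed.

(** * Scaling the weight *)

Lemma is_RInt_sum_f_R0 (f : nat -> R -> R) (a b : R) (l : nat -> R) (m : nat) :
  (forall p, is_RInt (f p) a b (l p)) ->
  is_RInt (fun u => sum_f_R0 (fun p => f p u) m) a b (sum_f_R0 l m).
Proof.
intros H. induction m as [|m IH]; simpl; [apply H|].
apply (is_RInt_plus (V := R_NormedModule) _ (f (S m))); [exact IH|apply H].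
Qed.

(** Expanding both factors of [(c + d u)^i (c + d u)^j] gives [L H L^T], with [L] the triangular
    array of coefficients; its diagonal [d^i] is free of [c]. *)
Lemma detn_affine_moments (n : nat) (c d : R) (nu : R -> R) : (forall u, continuous nu u) ->
  detn n (fun i j => RInt (fun u => (c + d * u) ^ (i + j) * nu u) 0 1) =
  prod1 (fun i => d ^ Nat.pred i) n ^ 2 *
  detn n (fun i j => RInt (fun u => u ^ (i + j) * nu u) 0 1).
Proof.
intros Hnu. set (L := affine_pow_coef c d).
rewrite (eq_detn n _ (fun i j => sum_f_R0 (fun p => sum_f_R0 (fun q =>
  L i p * L j q * RInt (fun u => u ^ (p + q) * nu u) 0 1) (Nat.pred n)) (Nat.pred n))).
- rewrite (detn_lower_congr n L) by (intros; apply affine_pow_coef_gt; assumption).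
  f_equal. f_equal. apply prod1_ext. intros k. apply affine_pow_coef_diag.
- intros i j Hi Hj. apply is_RInt_unique.
  apply (is_RInt_ext (V := R_NormedModule) (fun u => sum_f_R0 (fun p => sum_f_R0 (fun q =>
    scal (L i p * L j q) (u ^ (p + q) * nu u)) (Nat.pred n)) (Nat.pred n))).
  + intros u _. rewrite pow_add, (affine_pow_expand c d u i (Nat.pred n)),
      (affine_pow_expand c d u j (Nat.pred n)) by lia. fold L.
    rewrite Rmult_assoc, Rmult_comm, scal_sum. apply sum_eq. intros p _.
    rewrite (Rmult_comm _ (nu u)), <- Rmult_assoc, scal_sum. apply sum_eq. intros q _.
    unfold scal; simpl; unfold mult; simpl. rewrite pow_add. ring.
  + apply (is_RInt_sum_f_R0 (fun p u => sum_f_R0 (fun q => scal (L i p * L j q) (u ^ (p + q) * nu u)) (Nat.pred n))).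
    intros p.
    apply (is_RInt_sum_f_R0 (fun q u => scal (L i p * L j q) (u ^ (p + q) * nu u))). intros q.
    apply (is_RInt_scal (V := R_NormedModule) (fun u => u ^ (p + q) * nu u)).
    apply (RInt_correct (V := R_CompleteNormedModule)), ex_RInt_cont. intros x.
    apply (continuous_mult (fun u => u ^ (p + q)) nu); [|apply Hnu].
    apply (ex_derive_continuous (fun u => u ^ (p + q))). auto_derive. exact I.
Qed.

(** Only [d^2] enters, so the slopes [s] and [-s] are treated alike; the exponent is twice
    [0 + 1 + ... + (n-1)]. *)
Lemma prod1_pow_sqr (d s : R) (n : nat) : d ^ 2 = s ^ 2 ->
  prod1 (fun i => d ^ Nat.pred i) n ^ 2 = s ^ (n * Nat.pred n).
Proof.
intros H. induction n as [|n IH]; [simpl; ring|].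
rewrite prod1_S, Rpow_mult_distr, IH. simpl Nat.pred.
rewrite <- (pow_mult d), (Nat.mul_comm n 2), (pow_mult d), H, <- pow_mult, <- pow_add.
f_equal. destruct n; simpl; lia.
Qed.

Lemma RInt_mult_l (f : R -> R) (a b l : R) : ex_RInt f a b ->
  RInt (fun x => l * f x) a b = l * RInt f a b.
Proof. exact (RInt_scal (V := R_CompleteNormedModule) f a b l). Qed.

(** The exponent [a] belongs to the endpoint that [t] approaches, [g] to the point [t], and [b] to
    the far endpoint, whose factor tends to 1 with [s -> 0]. *)
Definition jacobi_moment (a b g s : R) (k : nat) : R :=
  RInt (fun u => u ^ k * (rpow u a * rpow (1 - u) g * rpow (1 - s * u) b)) 0 1.

Lemma continuous_rpow_affine (e c d u : R) : 0 < e -> continuous (fun u => rpow (c + d * u) e) u.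
Proof. intros He. apply continuous_rpow_comp; [exact He|apply continuous_affine]. Qed.

Lemma continuous_jacobi_weight (a b g s u : R) : 0 < a -> 0 < b -> 0 < g ->
  continuous (fun u => rpow u a * rpow (1 - u) g * rpow (1 - s * u) b) u.
Proof.
intros Ha Hb Hg.
apply (continuous_mult (fun u => rpow u a * rpow (1 - u) g) (fun u => rpow (1 - s * u) b)).
- apply continuous_Beta_integrand; assumption.
- apply continuous_ext with (fun u => rpow (1 + - s * u) b).
  + intros x. f_equal. ring.
  + apply continuous_rpow_affine, Hb.
Qed.

Lemma continuous_pow_mult (f : R -> R) (k : nat) (u : R) : continuous f u ->
  continuous (fun u => u ^ k * f u) u.
Proof.
intros Hf. apply (continuous_mult (fun u => u ^ k) f); [|exact Hf].
apply (ex_derive_continuous (fun u => u ^ k)). auto_derive. exact I.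
Qed.

(** For [0 < u < 1] the factor [(1 - s u)^b] lies between [(1 - s)^b] and 1; this sandwich replaces
    a passage to the limit under the integral. *)
Lemma jacobi_moment_bounds (a b g s : R) (k : nat) : 0 < a -> 0 < b -> 0 < g -> 0 < s < 1 ->
  Rpower (1 - s) b * Beta (a + INR k + 1) (g + 1) <= jacobi_moment a b g s k
  <= Beta (a + INR k + 1) (g + 1).
Proof.
intros Ha Hb Hg Hs. unfold jacobi_moment, Beta. pose proof (pos_INR k).
replace (a + INR k + 1 - 1) with (a + INR k) by ring. replace (g + 1 - 1) with g by ring.
assert (C : ex_RInt (fun u => rpow u (a + INR k) * rpow (1 - u) g) 0 1).
{ apply ex_RInt_cont; intros; apply continuous_Beta_integrand; lra. }
assert (C' : ex_RInt (fun u => u ^ k * (rpow u a * rpow (1 - u) g * rpow (1 - s * u) b)) 0 1).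
{ apply ex_RInt_cont; intros. apply continuous_pow_mult, continuous_jacobi_weight; lra. }
assert (B : forall u, 0 < u < 1 -> Rpower (1 - s) b <= rpow (1 - s * u) b <= 1).
{ intros u Hu. rewrite <- rpow_pos by lra. split; [apply rpow_le; nra|].
  apply Rle_trans with (rpow 1 b); [apply rpow_le; nra|rewrite rpow_1_l; lra]. }
assert (E : forall u, 0 < u < 1 -> 0 <= rpow u (a + INR k) * rpow (1 - u) g /\
  u ^ k * (rpow u a * rpow (1 - u) g * rpow (1 - s * u) b) =
  rpow (1 - s * u) b * (rpow u (a + INR k) * rpow (1 - u) g)).
{ intros u Hu. split; [apply Rmult_le_pos; apply rpow_ge_0|].
  rewrite <- (pow_mult_rpow u a k) by lra. ring. }
split.
- rewrite <- (RInt_mult_l _ 0 1 (Rpower (1 - s) b) C).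
  apply RInt_le; [lra| |exact C'|].
  + apply (ex_RInt_scal (V := R_NormedModule)), C.
  + intros u Hu. destruct (E u Hu) as [E1 E2]. rewrite E2.
    apply Rmult_le_compat_r; [exact E1|apply B, Hu].
- apply RInt_le; [lra|exact C'|exact C|].
  intros u Hu. destruct (E u Hu) as [E1 E2]. rewrite E2.
  destruct (B u Hu). nra.
Qed.

Lemma is_lim_jacobi_moment (a b g : R) (k : nat) : 0 < a -> 0 < b -> 0 < g ->
  filterlim (fun s => jacobi_moment a b g s k) (at_right 0)
    (locally (Beta (a + INR k + 1) (g + 1))).
Proof.
intros Ha Hb Hg. set (B := Beta (a + INR k + 1) (g + 1)).
apply (filterlim_locally (F := at_right 0)). intros eps.
assert (C : continuous (fun s => Rpower (1 - s) b * B) 0).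
{ apply (ex_derive_continuous (fun s => Rpower (1 - s) b * B)). unfold Rpower.
  auto_derive. lra. }
apply (filterlim_locally (F := locally 0) _ _) with (eps := eps) in C.
assert (D : locally 0 (fun s => s < 1)) by exact (open_lt 1 0 Rlt_0_1).
unfold at_right, within.
generalize (filter_and _ _ C D). apply filter_imp. intros s [Hs1 Hs2] Hs0.
pose proof (jacobi_moment_bounds a b g s k Ha Hb Hg ltac:(lra)) as [J1 J2]. fold B in J1, J2.
change (Rabs (Rpower (1 - s) b * B - Rpower (1 - 0) b * B) < eps) in Hs1.
change (Rabs (jacobi_moment a b g s k - B) < eps).
rewrite Rminus_0_r in Hs1. replace (Rpower 1 b) with 1 in Hs1
  by (rewrite <- rpow_pos, rpow_1_l by lra; reflexivity).
apply Rabs_lt_between in Hs1. apply Rabs_lt_between. pose proof (cond_pos eps). lra.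
Qed.

Lemma filterlim_detn (F : (R -> Prop) -> Prop) {FF : Filter F} (n : nat)
  (M : R -> nat -> nat -> R) (M0 : nat -> nat -> R) :
  (forall i j, filterlim (fun s => M s i j) F (locally (M0 i j))) ->
  filterlim (fun s => detn n (M s)) F (locally (detn n M0)).
Proof.
assert (Hsum : forall (f : R -> nat -> R) (l : nat -> R) m,
  (forall p, filterlim (fun s => f s p) F (locally (l p))) ->
  filterlim (fun s => sum_f_R0 (f s) m) F (locally (sum_f_R0 l m))).
{ intros f l m H. induction m as [|m IH]; simpl; [apply H|].
  apply (filterlim_comp_2 (G := locally (sum_f_R0 l m)) (H := locally (l (S m)))
    (fun s => sum_f_R0 (f s) m) (fun s => f s (S m)) Rplus IH (H (S m))).
  apply (filterlim_plus (K := R_AbsRing) (V := R_NormedModule)). }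
revert M M0; induction n as [|n IH]; intros M M0 H; simpl.
- apply filterlim_const.
- apply (Hsum (fun s j => (-1) ^ j * M s 0%nat j *
    detn n (fun i k => M s (S i) (if Nat.ltb k j then k else S k)))).
  intros j.
  apply (filterlim_comp_2 (G := locally ((-1) ^ j * M0 0%nat j))
    (H := locally (detn n (fun i k => M0 (S i) (if Nat.ltb k j then k else S k))))
    (fun s => (-1) ^ j * M s 0%nat j)
    (fun s => detn n (fun i k => M s (S i) (if Nat.ltb k j then k else S k))) Rmult).
  + apply (filterlim_comp_2 (G := locally ((-1) ^ j)) (H := locally (M0 0%nat j))
      (fun _ => (-1) ^ j) (fun s => M s 0%nat j) Rmult).
    * apply filterlim_const.
    * apply H.
    * apply (filterlim_mult (K := R_AbsRing)).
  + apply (IH (fun s i k => M s (S i) (if Nat.ltb k j then k else S k))). intros; apply H.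
  + apply (filterlim_mult (K := R_AbsRing)).
Qed.

(** * The change of variable in the moments of the weight *)

Lemma RInt01_eq (f : R -> R) : (forall x, continuous f x) -> RInt01 f = RInt f 0 1.
Proof.
intros Hf. unfold RInt01.
assert (H : exists v, exists pr : Riemann_integrable f 0 1, RiemannInt pr = v).
{ exists (RiemannInt (ex_RInt_Reals_0 f 0 1 (ex_RInt_cont f 0 1 Hf))).
  eexists; reflexivity. }
destruct (epsilon_spec (inhabits 0) _ H) as [pr Hpr]. rewrite <- Hpr.
symmetry. apply RInt_Reals.
Qed.

(** The vanishing of [rpow] on the nonpositive axis takes over the Heaviside cutoff, so that the
    weight is a product of continuous functions. *)
Lemma weight_right (al be g t x : R) :
  w al be g 0 1 t x = rpow x al * rpow (1 - x) be * rpow (x - t) g.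
Proof.
unfold w, theta. destruct (Rlt_dec 0 (x - t)) as [h|h].
- rewrite Rabs_pos_eq by lra. ring.
- rewrite (rpow_nonpos (x - t)) by lra. ring.
Qed.

Lemma weight_left (al be g t x : R) :
  w al be g 1 (-1) t x = rpow x al * rpow (1 - x) be * rpow (t - x) g.
Proof.
unfold w, theta. destruct (Rlt_dec 0 (x - t)) as [h|h].
- rewrite (rpow_nonpos (t - x)) by lra. ring.
- rewrite Rabs_left1 by lra. replace (- (x - t)) with (t - x) by ring. ring.
Qed.

Lemma continuous_weight (al be g c d x : R) : 0 < al -> 0 < be -> 0 < g ->
  continuous (fun x => rpow x al * rpow (1 - x) be * rpow (c + d * x) g) x.
Proof.
intros Ha Hb Hg.
apply (continuous_mult (fun x => rpow x al * rpow (1 - x) be)).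
- apply continuous_Beta_integrand; assumption.
- apply continuous_rpow_affine, Hg.
Qed.

Lemma RInt_zero (f : R -> R) (a b : R) : a <= b -> (forall x, a < x < b -> f x = 0) ->
  RInt f a b = 0.
Proof.
intros Hab H. rewrite (RInt_ext f (fun _ => 0)).
- rewrite RInt_const. unfold scal; simpl; unfold mult; simpl. ring.
- intros x. rewrite Rmin_left, Rmax_right by lra. apply H.
Qed.

(** The power of [t] collects the Jacobian, [t^al] from [x = t u] and [t^g] from
    [t - x = t (1 - u)]. The form [0 + t * u] fits the affine pattern [c + d * u] shared with
    [moment_right]. *)
Lemma moment_left (al be g t : R) (k : nat) : 0 < al -> 0 < be -> 0 < g -> 0 < t < 1 ->
  RInt01 (fun x => x ^ k * w al be g 1 (-1) t x) =
  Rpower t (1 + al + g) * RInt (fun u => (0 + t * u) ^ k *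
     (rpow u al * rpow (1 - u) g * rpow (1 - t * u) be)) 0 1.
Proof.
intros Ha Hb Hg Ht.
pose (f := fun x => x ^ k * (rpow x al * rpow (1 - x) be * rpow (t + (-1) * x) g)).
assert (Cf : forall x, continuous f x).
{ intros x. apply continuous_pow_mult, continuous_weight; assumption. }
assert (E : (fun x => x ^ k * w al be g 1 (-1) t x) = f).
{ apply FunctionalExtensionality.functional_extensionality. intros x.
  rewrite weight_left. unfold f. do 3 f_equal. ring. }
rewrite E, RInt01_eq by assumption.
rewrite <- (RInt_Chasles f 0 t 1) by (apply ex_RInt_cont, Cf).
rewrite (RInt_zero f t 1) by (try lra; intros x Hx; unfold f; rewrite (rpow_nonpos (t + _)) by lra; ring).
pose proof (RInt_comp_lin (V := R_CompleteNormedModule) f t 0 0 1 (ex_RInt_cont f _ _ Cf)) as S.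
replace (t * 0 + 0) with 0 in S by ring. replace (t * 1 + 0) with t in S by ring.
rewrite <- S.
rewrite <- RInt_mult_l.
2:{ apply ex_RInt_cont. intros x.
    apply (continuous_mult (fun u => (0 + t * u) ^ k)).
    - apply (ex_derive_continuous (fun u => (0 + t * u) ^ k)). auto_derive. exact I.
    - apply continuous_jacobi_weight; assumption. }
change plus with Rplus. rewrite Rplus_0_r. apply RInt_ext. intros u _.
unfold f, scal; simpl; unfold mult; simpl.
replace (t + -1 * (t * u + 0)) with (t * (1 - u)) by ring.
replace (t * u + 0) with (t * u) by ring. rewrite Rplus_0_l, !rpow_mult_distr, !Rpower_plus, Rpower_1 by lra.
Rring.
Qed.

Lemma moment_right (al be g s : R) (k : nat) : 0 < al -> 0 < be -> 0 < g -> 0 < s < 1 ->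
  RInt01 (fun x => x ^ k * w al be g 0 1 (1 - s) x) =
  Rpower s (1 + be + g) * RInt (fun u => (1 + - s * u) ^ k *
     (rpow u be * rpow (1 - u) g * rpow (1 - s * u) al)) 0 1.
Proof.
intros Ha Hb Hg Hs.
pose (f := fun x => x ^ k * (rpow x al * rpow (1 - x) be * rpow (- (1 - s) + 1 * x) g)).
assert (Cf : forall x, continuous f x).
{ intros x. apply continuous_pow_mult, continuous_weight; assumption. }
assert (E : (fun x => x ^ k * w al be g 0 1 (1 - s) x) = f).
{ apply FunctionalExtensionality.functional_extensionality. intros x.
  rewrite weight_right. unfold f. do 3 f_equal. ring. }
rewrite E, RInt01_eq by assumption.
rewrite <- (RInt_Chasles f 0 (1 - s) 1) by (apply ex_RInt_cont, Cf).
rewrite (RInt_zero f 0 (1 - s)) by (try lra; intros x Hx; unfold f; rewrite (rpow_nonpos (- (1 - s) + _)) by lra; ring).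
pose proof (RInt_comp_lin (V := R_CompleteNormedModule) f (- s) 1 0 1 (ex_RInt_cont f _ _ Cf)) as S.
replace (- s * 0 + 1) with 1 in S by ring. replace (- s * 1 + 1) with (1 - s) in S by ring.
(* The map [u -> 1 - s u] reverses orientation: the sign of its Jacobian [-s] is absorbed by
   swapping the bounds. *)
rewrite <- (opp_RInt_swap (V := R_CompleteNormedModule) f 1 (1 - s)), <- S by (apply ex_RInt_cont, Cf).
rewrite <- (RInt_opp (V := R_CompleteNormedModule)).
2:{ apply (ex_RInt_comp_lin (V := R_NormedModule)), ex_RInt_cont, Cf. }
rewrite <- RInt_mult_l.
2:{ apply ex_RInt_cont. intros x.
    apply (continuous_mult (fun u => (1 + - s * u) ^ k)).
    - apply (ex_derive_continuous (fun u => (1 + - s * u) ^ k)). auto_derive. exact I.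
    - apply continuous_jacobi_weight; assumption. }
change plus with Rplus. rewrite Rplus_0_l. apply RInt_ext. intros u _.
unfold f, scal, opp; simpl; unfold mult; simpl.
replace (- (1 - s) + 1 * (- s * u + 1)) with (s * (1 - u)) by ring.
replace (1 - (- s * u + 1)) with (s * u) by ring.
replace (- s * u + 1) with (1 + - s * u) by ring.
replace (rpow (1 - s * u) al) with (rpow (1 + - s * u) al) by (f_equal; ring).
rewrite !rpow_mult_distr, !Rpower_plus, Rpower_1 by lra.
Rring.
Qed.

(** The [n] rows contribute [s^(n(1+a+g))] and the slope [s^(n(n-1))], in all [s^(n(n+a+g))]. *)
Lemma detn_scaled_moments (n : nat) (a b g s c d : R) :
  0 < a -> 0 < b -> 0 < g -> 0 < s -> d ^ 2 = s ^ 2 ->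
  detn n (fun i j => Rpower s (1 + a + g) * RInt (fun u => (c + d * u) ^ (i + j) *
     (rpow u a * rpow (1 - u) g * rpow (1 - s * u) b)) 0 1) =
  Rpower s (INR n * (INR n + a + g)) * detn n (fun i j => jacobi_moment a b g s (i + j)).
Proof.
intros Ha Hb Hg Hs Hd.
rewrite (eq_detn n _ (fun i j => Rpower s (1 + a + g) * 1 * RInt (fun u => (c + d * u) ^ (i + j) *
     (rpow u a * rpow (1 - u) g * rpow (1 - s * u) b)) 0 1)) by (intros; ring).
rewrite (detn_scal n (fun _ => Rpower s (1 + a + g)) (fun _ => 1)), !prod1_const, pow1.
rewrite detn_affine_moments by (intros; apply continuous_jacobi_weight; assumption).
rewrite (prod1_pow_sqr d s n Hd), <- !Rpower_pow, Rpower_mult by (try apply exp_pos; assumption).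
fold (jacobi_moment a b g s).
rewrite Rmult_1_r, <- Rmult_assoc, <- Rpower_plus. f_equal.
f_equal. rewrite mult_INR. destruct n as [|n]; [simpl; ring|].
simpl Nat.pred. rewrite S_INR. ring.
Qed.

(** Common core of both limits: the power of [s] cancels, and dividing by the positive [Cconst]
    makes the error relative. The clause [s < 1] keeps [t] inside (0,1) for the moment lemmas. *)
Lemma scaled_determinant_limit (n : nat) (a b g : R) : 0 < a -> 0 < b -> 0 < g ->
  forall eps, 0 < eps -> exists delta, 0 < delta /\ forall s, 0 < s < delta -> s < 1 /\
  Rabs (Rpower s (INR n * (INR n + a + g)) * detn n (fun i j => jacobi_moment a b g s (i + j)) /
        (Cconst a g n * Rpower s (INR n * (INR n + a + g))) - 1) < eps.
Proof.
intros Ha Hb Hg eps Heps. pose proof (Cconst_pos a g n Ha Hg) as HC.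
assert (L : filterlim (fun s => detn n (fun i j => jacobi_moment a b g s (i + j))) (at_right 0)
   (locally (Cconst a g n))).
{ rewrite <- detn_Beta by assumption.
  apply (filterlim_detn (at_right 0) n (fun s i j => jacobi_moment a b g s (i + j))).
  intros i j. apply is_lim_jacobi_moment; assumption. }
assert (He : 0 < eps * Cconst a g n) by (apply Rmult_lt_0_compat; assumption).
apply (filterlim_locally (F := at_right 0)) with (eps := mkposreal _ He) in L.
destruct L as [r Hr]. exists (Rmin r 1). split.
{ apply Rmin_glb_lt; [apply cond_pos|lra]. }
intros s Hs. pose proof (Rmin_l r 1). pose proof (Rmin_r r 1). split; [lra|].
assert (B : Rabs (detn n (fun i j => jacobi_moment a b g s (i + j)) - Cconst a g n)
   < eps * Cconst a g n).
{ apply Hr; [|lra]. change (Rabs (s - 0) < r). rewrite Rabs_pos_eq; lra. }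
set (D := detn n _) in *. assert (0 < Rpower s (INR n * (INR n + a + g))) by apply exp_pos.
replace (Rpower s (INR n * (INR n + a + g)) * D /
  (Cconst a g n * Rpower s (INR n * (INR n + a + g))) - 1)
  with ((D - Cconst a g n) / Cconst a g n) by (field; lra).
rewrite Rabs_div, (Rabs_pos_eq (Cconst a g n)) by lra.
apply Rmult_lt_reg_r with (Cconst a g n); [exact HC|].
replace (Rabs (D - Cconst a g n) / Cconst a g n * Cconst a g n)
  with (Rabs (D - Cconst a g n)) by (field; lra). exact B.
Qed.

Theorem theorem4p2 (alpha beta gamma : R) (n : nat) :
  0 < alpha -> 0 < beta -> 0 < gamma -> (1 <= n)%nat ->
  (* (i) A = 0, B = 1, t -> 1^- *)
  (forall eps, 0 < eps -> exists delta, 0 < delta /\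
     forall t, 1 - delta < t < 1 ->
       Rabs (Dn alpha beta gamma 0 1 n t /
             (Cconst beta gamma n * Rpower (1 - t) (INR n * (INR n + beta + gamma))) - 1) < eps)
  /\
  (* (ii) A = 1, B = -1, t -> 0^+ *)
  (forall eps, 0 < eps -> exists delta, 0 < delta /\
     forall t, 0 < t < delta ->
       Rabs (Dn alpha beta gamma 1 (-1) n t /
             (Cconst alpha gamma n * Rpower t (INR n * (INR n + alpha + gamma))) - 1) < eps).
Proof.
intros Ha Hb Hg _. split; intros eps Heps.
(* Near [t = 1] the scale is [s = 1 - t], and [alpha] and [beta] exchange roles. *)
- destruct (scaled_determinant_limit n beta alpha gamma Hb Ha Hg eps Heps) as [delta [Hd H]].
  exists delta. split; [exact Hd|]. intros t Ht.
  destruct (H (1 - t) ltac:(lra)) as [Hs B].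
  unfold Dn. rewrite (eq_detn n _ (fun i j => Rpower (1 - t) (1 + beta + gamma) *
    RInt (fun u => (1 + - (1 - t) * u) ^ (i + j) *
     (rpow u beta * rpow (1 - u) gamma * rpow (1 - (1 - t) * u) alpha)) 0 1)).
  + rewrite detn_scaled_moments by (try lra; ring). exact B.
  + intros i j _ _. replace (w alpha beta gamma 0 1 t) with (w alpha beta gamma 0 1 (1 - (1 - t)))
      by (f_equal; ring).
    apply moment_right; lra.
- destruct (scaled_determinant_limit n alpha beta gamma Ha Hb Hg eps Heps) as [delta [Hd H]].
  exists delta. split; [exact Hd|]. intros t Ht.
  destruct (H t Ht) as [Hs B].
  unfold Dn. rewrite (eq_detn n _ (fun i j => Rpower t (1 + alpha + gamma) *
    RInt (fun u => (0 + t * u) ^ (i + j) *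
     (rpow u alpha * rpow (1 - u) gamma * rpow (1 - t * u) beta)) 0 1)).
  + rewrite detn_scaled_moments by (try lra; ring). exact B.
  + intros i j _ _. apply moment_left; lra.
Qed.
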